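(* Let $f:\mathbb{R}^{d_1}\times\mathbb{R}^{d_2}\to\mathbb{R}$ be continuously differentiable, have Lipschitz gradient with constant $l>0$, satisfy the existence-of-saddle-point assumption, and satisfy the two-sided PL condition with constants $\mu_1,\mu_2>0$, where $\mu_1,\mu_2\le l$. Let $G_x,G_y$ be unbiased stochastic gradients of $f$ with variance bounded by $\sigma^2$. Let $(x_t,y_t)_{t\ge 0}$ be generated by Stoc-AGDA with constant stepsizes $\tau_2^t=\tau_2$ and $\tau_1^t=\tau_1$ for all $t$, where $0<\tau_2\le \frac1l$ and $0<\tau_1\le \frac{\mu_2^2\tau_2}{18l^2}$. Put $P_t:=a_t+\frac1{10}b_t$. Then for all $t\ge 0$, $$P_t\le \Big(1-\tfrac12\mu_1\tau_1\Big)^tP_0+\delta,\qquad \delta=\frac{(1-\mu_2\tau_2)(L+l)\tau_1^2+l\tau_2^2+10L\tau_1^2}{10\mu_1\tau_1}\,\sigma^2 .$$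
   Context: Norms are Euclidean. Problem: $\min_{x\in\mathbb{R}^{d_1}}\max_{y\in\mathbb{R}^{d_2}} f(x,y)$. Lipschitz gradient with constant $l$: for all $x_1,x_2\in\mathbb{R}^{d_1}$, $y_1,y_2\in\mathbb{R}^{d_2}$, $\|\nabla_x f(x_1,y_1)-\nabla_x f(x_2,y_2)\|\le l[\|x_1-x_2\|+\|y_1-y_2\|]$ and $\|\nabla_y f(x_1,y_1)-\nabla_y f(x_2,y_2)\|\le l[\|x_1-x_2\|+\|y_1-y_2\|]$. Existence of saddle point: there is $(x^*,y^* )$ with $f(x^*,y)\le f(x^*,y^* )\le f(x,y^* )$ for all $(x,y)$; moreover for every $y$, $\min_x f(x,y)$ has a nonempty solution set and finite optimal value, and for every $x$, $\max_y f(x,y)$ has a nonempty solution set and finite optimal value. Two-sided PL condition with constants $\mu_1,\mu_2>0$: for all $(x,y)$, $\|\nabla_x f(x,y)\|^2\ge 2\mu_1[f(x,y)-\min_{x'}f(x',y)]$ and $\|\nabla_y f(x,y)\|^2\ge 2\mu_2[\max_{y'}f(x,y')-f(x,y)]$. Stochastic gradients: $G_x(x,y,\xi),G_y(x,y,\xi)$, with $\xi$ a random vector of law $P$, satisfy for every $(x,y)$: $\mathbb{E}_\xi[G_x(x,y,\xi)]=\nabla_x f(x,y)$, $\mathbb{E}_\xi[G_y(x,y,\xi)]=\nabla_y f(x,y)$, $\mathbb{E}_\xi\|G_x(x,y,\xi)-\nabla_xf(x,y)\|^2\le\sigma^2$, $\mathbb{E}_\xi\|G_y(x,y,\xi)-\nabla_yf(x,y)\|^2\le\sigma^2$.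 Stoc-AGDA: from a given $(x_0,y_0)$, for $t=0,1,2,\dots$ draw two i.i.d. samples $\xi_{t1},\xi_{t2}\sim P$ (independent of the past) and set $x_{t+1}=x_t-\tau_1^tG_x(x_t,y_t,\xi_{t1})$, then $y_{t+1}=y_t+\tau_2^tG_y(x_{t+1},y_t,\xi_{t2})$. Notation: $g(x):=\max_y f(x,y)$, $g^*:=\min_x g(x)$, $a_t:=\mathbb{E}[g(x_t)-g^*]$, $b_t:=\mathbb{E}[g(x_t)-f(x_t,y_t)]$, $L:=l+l^2/\mu_2$. *)

(* Defs.v *)
From HB Require Import structures.
From mathcomp Require Import all_boot all_order all_algebra.
From mathcomp Require Import all_classical all_reals all_analysis.

Set Implicit Arguments.
Unset Strict Implicit.
Unset Printing Implicit Defensive.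

Import Order.TTheory GRing.Theory Num.Theory.
Import numFieldNormedType.Exports.

Local Open Scope classical_set_scope.
Local Open Scope ring_scope.

(* The library norm `|x| on 'rV[R]_d is the sup norm, hence the following. *)
Definition enorm (R : realType) (d : nat) (x : 'rV[R]_d) : R :=
  Num.sqrt (\sum_(i < d) x 0 i ^+ 2).

Definition grad (R : realType) (d : nat) (h : 'rV[R]_d -> R) (x : 'rV[R]_d) :
    'rV[R]_d :=
  \row_(i < d) 'D_(delta_mx 0 i) h x.

Section Problem.
Context {R : realType} {d1 d2 : nat}.
Implicit Types f : 'rV[R]_d1 -> 'rV[R]_d2 -> R.

Definition gradx f (x : 'rV[R]_d1) (y : 'rV[R]_d2) : 'rV[R]_d1 :=
  grad (fun x' => f x' y) x.

Definition grady f (x : 'rV[R]_d1) (y : 'rV[R]_d2) : 'rV[R]_d2 :=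
  grad (fun y' => f x y') y.

Definition continuously_differentiable f : Prop :=
  [/\ forall z, differentiable (fun z : 'rV[R]_d1 * 'rV[R]_d2 => f z.1 z.2) z,
      continuous (fun z : 'rV[R]_d1 * 'rV[R]_d2 => gradx f z.1 z.2) &
      continuous (fun z : 'rV[R]_d1 * 'rV[R]_d2 => grady f z.1 z.2)].

Definition lipschitz_gradient f (l : R) : Prop :=
  forall x1 x2 y1 y2,
    enorm (gradx f x1 y1 - gradx f x2 y2)
      <= l * (enorm (x1 - x2) + enorm (y1 - y2)) /\
    enorm (grady f x1 y1 - grady f x2 y2)
      <= l * (enorm (x1 - x2) + enorm (y1 - y2)).

(* Optimal values are taken as infima and suprema of the (real) set of values;
   they are finite and attained under [saddle_point_existence]. *)
Definition min_x f (y : 'rV[R]_d2) : R := inf (range (fun x => f x y)).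

Definition max_y f (x : 'rV[R]_d1) : R := sup (range (fun y => f x y)).

Definition min_max f : R := inf (range (max_y f)).

Definition saddle_point_existence f : Prop :=
  [/\ exists xs ys, forall x y, f xs y <= f xs ys /\ f xs ys <= f x ys,
      forall y, exists xs, forall x, f xs y <= f x y &
      forall x, exists ys, forall y, f x y <= f x ys].

Definition two_sided_PL f (mu1 mu2 : R) : Prop :=
  forall x y,
    2 * mu1 * (f x y - min_x f y) <= enorm (gradx f x y) ^+ 2 /\
    2 * mu2 * (max_y f x - f x y) <= enorm (grady f x y) ^+ 2.

End Problem.

Definition borel_rV (R : realType) (d : nat) :=
  g_sigma_algebraType (@open 'rV[R]_d).

Section Stochastic.
Context {R : realType} {d1 d2 : nat} {dXi : measure_display}
  {Xi : measurableType dXi}.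

(* [G] is a jointly measurable, unbiased estimator of [v] with variance at most
   sigma ^ 2. The expectation of a random vector is taken coordinatewise. Since each
   'E_P[_] is an extended real, equality with a real number entails that the
   coordinate is integrable. *)
Definition unbiased_bounded_variance (d : nat) (P : probability Xi R)
    (G : 'rV[R]_d1 -> 'rV[R]_d2 -> Xi -> 'rV[R]_d)
    (v : 'rV[R]_d1 -> 'rV[R]_d2 -> 'rV[R]_d) (sigma : R) : Prop :=
  [/\ measurable_fun
        [set: (borel_rV R d1 * borel_rV R d2) * Xi]
        (fun z : (borel_rV R d1 * borel_rV R d2) * Xi =>
           G z.1.1 z.1.2 z.2 : borel_rV R d),
      forall x y i, ('E_P[(fun xi => G x y xi 0 i)%R] = (v x y 0 i)%:E)%E &
      forall x y,
        ('E_P[(fun xi => enorm (G x y xi - v x y) ^+ 2)%R] <= (sigma ^+ 2)%:E)%E].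

Fixpoint stoc_agda (Gx : 'rV[R]_d1 -> 'rV[R]_d2 -> Xi -> 'rV[R]_d1)
    (Gy : 'rV[R]_d1 -> 'rV[R]_d2 -> Xi -> 'rV[R]_d2) (tau1 tau2 : nat -> R)
    (x0 : 'rV[R]_d1) (y0 : 'rV[R]_d2) (s1 s2 : nat -> Xi) (t : nat) :
    'rV[R]_d1 * 'rV[R]_d2 :=
  if t is t'.+1 then
    let z := stoc_agda Gx Gy tau1 tau2 x0 y0 s1 s2 t' in
    let x := z.1 - tau1 t' *: Gx z.1 z.2 (s1 t') in
    (x, z.2 + tau2 t' *: Gy x z.2 (s2 t'))
  else (x0, y0).

End Stochastic.

Definition mutually_independent (R : realType) (dO dXi : measure_display)
    (Omega : measurableType dO) (Xi : measurableType dXi)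
    (Q : probability Omega R) (I : choiceType) (X : I -> {RV Q >-> Xi}) : Prop :=
  forall (J : seq I) (A : I -> set Xi), uniq J ->
    (forall i, i \in J -> measurable (A i)) ->
    Q (\bigcap_(i in [set` J]) X i @^-1` A i) =
      (\prod_(i <- J) Q (X i @^-1` A i))%E.

(* All draws, over both kinds and all times, are i.i.d. with law P; since x_0
   and y_0 are deterministic and x_t, y_t are functions of the draws at times
   before t, this is freshness of the draws at time t. *)
Definition iid_samples (R : realType) (dO dXi : measure_display)
    (Omega : measurableType dO) (Xi : measurableType dXi)
    (Q : probability Omega R) (P : probability Xi R)
    (xi1 xi2 : nat -> {RV Q >-> Xi}) : Prop :=
  (forall t A, measurable A ->
     distribution Q (xi1 t) A = P A /\ distribution Q (xi2 t) A = P A) /\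
  mutually_independent
    (fun k : nat + nat => match k with inl t => xi1 t | inr t => xi2 t end).

Section Potential.
Context {R : realType} {d1 d2 : nat} {dO : measure_display}
  {Omega : measurableType dO}.
Variables (Q : probability Omega R) (f : 'rV[R]_d1 -> 'rV[R]_d2 -> R).
Variable z : nat -> Omega -> 'rV[R]_d1 * 'rV[R]_d2.

Definition primal_gap (t : nat) : \bar R :=
  'E_Q[(fun w => max_y f (z t w).1 - min_max f)%R]%E.

Definition dual_gap (t : nat) : \bar R :=
  'E_Q[(fun w => max_y f (z t w).1 - f (z t w).1 (z t w).2)%R]%E.

Definition potential (t : nat) : \bar R := (primal_gap t + (1 / 10)%:E * dual_gap t)%E.

End Potential.

(* Main.v *)
(** With [g x = max_y f x y], the PL condition in [y] gives quadratic growth away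
    from the maximisers, hence the set of maximisers of [f x] moves in an
    [l / mu2]-Lipschitz way with [x], so that [g] satisfies a descent inequality
    with constant [L = l + l ^ 2 / mu2] whose slope at [x] is [gradx f x ys] for
    any maximiser [ys]; the PL condition in [x] at [(x, ys)] makes [g] a PL function.
    Averaging the descent inequalities over one fresh sample at a time, the
    potential [(g x - min g) + (g x - f x y) / 10] contracts by
    [1 - mu1 * tau1 / 2] up to a constant noise term; since each sample is
    independent of the current state, Tonelli's theorem turns this into a
    recursion on expectations, which is summed as a geometric series. *)
Require Import Defs.
From mathcomp Require Import all_boot all_order all_algebra.
From mathcomp Require Import all_classical all_reals all_analysis.
From mathcomp Require Import measurable_realfun ring lra.
Import Order.TTheory GRing.Theory Num.Theory.
Import numFieldNormedType.Exports.
Local Open Scope classical_set_scope.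
Local Open Scope ring_scope.

Set Implicit Arguments.
Unset Strict Implicit.
Unset Printing Implicit Defensive.

(** * Euclidean geometry and the descent inequality *)

(** Maximisers of [f x] need not be unique and [max_y f] is never differentiated: wherever its slope
    is wanted, [gradx f x ys] at some maximiser [ys] serves, and only the two one-sided quadratic
    bounds are proved. Quadratic growth comes from a compactness argument, whose price is a constant
    strictly below the sharp one, [c ^+ 2 < mu / 2]. The loss disappears in [max_y_upper] by a
    limit, so [L] is exact; in the one-step estimate it is absorbed by slack in the stepsize bound.
    The x-step follows [gradx f x y] instead of the slope at a maximiser; the error is at most [l]
    times the distance from [y] to the maximisers, hence is controlled by the dual gap. The weight
    1/10 and the factor 18 balance this error against the contraction of the dual gap. On the
    probabilistic side all integrated quantities are kept nonnegative, so monotonicity and Tonelli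
    hold in the extended reals without integrability of [f] along the iterates, and independence is
    carried by the predicate [fresh] in place of filtrations and conditional expectations. *)

Definition dot (R : realType) (d : nat) (u v : 'rV[R]_d) : R :=
  \sum_(i < d) u 0 i * v 0 i.
Arguments dot {R d}.

Section Euclidean.
Context {R : realType} {d : nat}.
Implicit Types u v w : 'rV[R]_d.

Lemma dotC u v : dot u v = dot v u.
Proof. by apply: eq_bigr => i _; rewrite mulrC. Qed.

Lemma dotDl u v w : dot (u + v) w = dot u w + dot v w.
Proof. by rewrite -big_split; apply: eq_bigr => i _; rewrite mxE mulrDl. Qed.

Lemma dotZl (a : R) u v : dot (a *: u) v = a * dot u v.
Proof. by rewrite /dot mulr_sumr; apply: eq_bigr => i _; rewrite mxE mulrA. Qed.

Lemma dotDr u v w : dot u (v + w) = dot u v + dot u w.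
Proof. by rewrite dotC dotDl dotC [dot w u]dotC. Qed.

Lemma dotZr (a : R) u v : dot u (a *: v) = a * dot u v.
Proof. by rewrite dotC dotZl dotC. Qed.

Lemma dotNl u v : dot (- u) v = - dot u v.
Proof. by rewrite -scaleN1r dotZl mulN1r. Qed.

Lemma dotNr u v : dot u (- v) = - dot u v.
Proof. by rewrite dotC dotNl dotC. Qed.

Lemma dot0r u : dot u 0 = 0.
Proof. by rewrite -(scale0r 0) dotZr mul0r. Qed.

Definition dotE := (dotDl, dotDr, dotNl, dotNr, dotZl, dotZr).

Lemma dot_ge0 u : 0 <= dot u u.
Proof. by apply: sumr_ge0 => i _; rewrite -expr2 sqr_ge0. Qed.

Lemma enorm_sqr u : enorm u ^+ 2 = dot u u.
Proof.
rewrite /enorm sqr_sqrtr; first by apply: eq_bigr => i _; rewrite expr2.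
by apply: sumr_ge0 => i _; rewrite sqr_ge0.
Qed.

Lemma enorm_ge0 u : 0 <= enorm u.
Proof. exact: sqrtr_ge0. Qed.

Lemma coord_le_enorm u i : `|u 0 i| <= enorm u.
Proof.
rewrite -(@ler_pXn2r _ 2) ?nnegrE ?enorm_ge0// -normrX ger0_norm ?sqr_ge0//.
rewrite enorm_sqr /dot (bigD1 i)//= -expr2 lerDl.
by apply: sumr_ge0 => j _; rewrite -expr2 sqr_ge0.
Qed.

Lemma enorm0_eq0 u : enorm u = 0 -> u = 0.
Proof.
move=> u0; apply/rowP => i; apply/eqP; rewrite mxE -normr_le0.
by rewrite (le_trans (coord_le_enorm u i))// u0.
Qed.

Lemma enorm0 : enorm (0 : 'rV[R]_d) = 0.
Proof. by apply/eqP; rewrite -sqrf_eq0 enorm_sqr dot0r. Qed.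

Lemma cauchy_schwarz u v : dot u v <= enorm u * enorm v.
Proof.
have [u0|u0] := eqVneq (enorm u) 0.
  by rewrite u0 mul0r (enorm0_eq0 u0) dotC dot0r.
have [v0|v0] := eqVneq (enorm v) 0.
  by rewrite v0 mulr0 (enorm0_eq0 v0) dot0r.
have up : 0 < enorm u by rewrite lt0r u0 enorm_ge0.
have vp : 0 < enorm v by rewrite lt0r v0 enorm_ge0.
have := dot_ge0 (enorm v *: u - enorm u *: v).
rewrite !dotE -!enorm_sqr (dotC v u) => H.
rewrite -(ler_pM2l (mulr_gt0 up vp)).
nra.
Qed.

Lemma enormZ (a : R) u : enorm (a *: u) = `|a| * enorm u.
Proof.
apply/eqP; rewrite -(@eqrXn2 _ 2) ?mulr_ge0 ?enorm_ge0//.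
by rewrite enorm_sqr exprMn enorm_sqr !dotE real_normK ?num_real// mulrA.
Qed.

Lemma enormN u : enorm (- u) = enorm u.
Proof. by rewrite -scaleN1r enormZ normrN normr1 mul1r. Qed.

Lemma enormD u v : enorm (u + v) <= enorm u + enorm v.
Proof.
rewrite -(@ler_pXn2r _ 2) ?nnegrE ?addr_ge0 ?enorm_ge0//.
rewrite enorm_sqr !dotE -!enorm_sqr (dotC v u).
by have := cauchy_schwarz u v; nra.
Qed.

Lemma enormB_sqr_le u v : enorm (u - v) ^+ 2 <= 2 * enorm u ^+ 2 + 2 * enorm v ^+ 2.
Proof.
rewrite !enorm_sqr !dotE (dotC v u); have := dot_ge0 (u + v).
by rewrite !dotE (dotC v u); lra.
Qed.

Lemma continuous_enorm : continuous (@enorm R d).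
Proof.
move=> x; rewrite /enorm; apply: continuous_comp; last exact: sqrt_continuous.
apply: continuous_big => [|i _]; first exact: add_continuous.
move=> z; exact: (cvg_comp _ _ (@coord_continuous R 1 d 0 i z) (@exprn_continuous R 2 _)).
Qed.

End Euclidean.

Section Descent.
Context {R : realType} {d : nat}.
Variables (h : 'rV[R]_d -> R) (l : R).
Hypothesis dh : forall z, differentiable h z.

Lemma derive_grad z v : 'D_v h z = dot (grad h z) v.
Proof.
rewrite deriveE// {1}(row_sum_delta v) linear_sum.
apply: eq_bigr => i _; rewrite linearZ/= mxE deriveE//.
by rewrite mulrC.
Qed.

Lemma is_derive_line y v (t : R) :
  is_derive t 1 (fun s : R => h (y + s *: v)) (dot (grad h (y + t *: v)) v).
Proof.
have E : (fun k : R => k^-1 *: (h (y + (k *: 1 + t) *: v) - h (y + t *: v))) =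
         (fun k : R => k^-1 *: (h (k *: v + (y + t *: v)) - h (y + t *: v))).
  apply/funext => k; congr (_ *: (h _ - _)).
  by rewrite scalerDl addrCA /GRing.scale/= mulr1.
split; first by rewrite /derivable E; exact: diff_derivable.
by rewrite -derive_grad /derive E.
Qed.

Hypothesis lip : forall z1 z2,
  enorm (grad h z1 - grad h z2) <= l * enorm (z1 - z2).

Lemma descent y v :
  `|h (y + v) - h y - dot (grad h y) v| <= l / 2 * enorm v ^+ 2.
Proof.
suff H e : `|e| = 1 ->
    e * (h (y + v) - h y - dot (grad h y) v) <= l / 2 * enorm v ^+ 2.
  rewrite ler_norml lerNl; apply/andP; split.
    by have := H (-1); rewrite mulN1r; apply; rewrite normrN normr1.
  by have := H 1; rewrite mul1r; apply; rewrite normr1.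
move=> e1.
(* Subtracting the quadratic makes [dp] nonpositive on the unit interval, by Cauchy-Schwarz and the
   Lipschitz bound, so the mean value theorem yields [p 1 <= p 0]. The sign [e] covers both halves
   of the absolute value. *)
pose p (s : R) := e * (h (y + s *: v) - s * dot (grad h y) v)
                  - l / 2 * enorm v ^+ 2 * s ^+ 2.
pose dp (s : R) := e * dot (grad h (y + s *: v) - grad h y) v
                  - l * enorm v ^+ 2 * s.
have dpE (s : R) : is_derive s 1 p (dp s).
  have := is_derive_line y v s => ?.
  rewrite /p; apply: is_derive_eq.
  rewrite /dp dotDl dotNl; set D := dot (grad h (y + s *: v)) v.
  by rewrite /GRing.scale/=; field.
have [s] : exists2 s : R, s \in `[0, 1] & p 1 - p 0 = dp s * (1 - 0).
  apply: MVT_segment => //.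
  apply: continuous_subspaceT => s.
  by apply: differentiable_continuous; apply/derivable1_diffP; case: (dpE s).
rewrite in_itv/= => /andP[s0 s1].
rewrite /p /dp scale1r scale0r addr0 subr0 mulr1 => eqp.
have : e * dot (grad h (y + s *: v) - grad h y) v <= s * l * enorm v ^+ 2.
  rewrite -dotZl; apply: le_trans (cauchy_schwarz _ _) _.
  rewrite enormZ e1 mul1r expr2 mulrA ler_wpM2r ?enorm_ge0//.
  apply: le_trans (lip _ _) _.
  by rewrite addrAC subrr add0r enormZ ger0_norm// mulrCA mulrA.
lra.
Qed.

End Descent.

(** * Quadratic growth under the PL condition *)

Section QuadraticGrowth.
Context {R : realType} {d : nat}.
Variables (h : 'rV[R]_d -> R) (gr : 'rV[R]_d -> 'rV[R]_d) (l mu M : R).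
Hypotheses (l_gt0 : 0 < l) (mu_gt0 : 0 < mu) (ch : continuous h).
Hypothesis lower : forall y v,
  h y + dot (gr y) v - l / 2 * enorm v ^+ 2 <= h (y + v).
Hypothesis hM : forall y, h y <= M.
Hypothesis PL : forall y, 2 * mu * (M - h y) <= enorm (gr y) ^+ 2.

Lemma continuous_enormB (y0 : 'rV[R]_d) : continuous (fun y : 'rV[R]_d => enorm (y - y0)).
Proof.
move=> y.
exact: (cvg_comp _ _ (cvgB cvg_id (cvg_cst y0)) (@continuous_enorm R d _)).
Qed.

Lemma compact_eball (y0 : 'rV[R]_d) (r : R) :
  compact [set y | enorm (y - y0) <= r].
Proof.
apply: bounded_closed_compact.
  exists (`|y0| + `|r|); split; first exact: num_real.
  move=> x ltx y /= yr; apply: le_trans (ltW ltx).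
  rewrite -[y](subrK y0) addrC (le_trans (ler_normD _ _))// lerD2l.
  rewrite [leLHS]mx_normrE; apply/bigmax_leP; split => //= -[i j] _ /=.
  rewrite (ord1 i) (le_trans (coord_le_enorm _ _))// (le_trans yr)//.
  exact: ler_norm.
rewrite [X in closed X](_ : _ = (fun y => enorm (y - y0)) @^-1` [set x | x <= r])//.
apply: closed_comp; last exact: closed_le.
by move=> y _; exact: continuous_enormB.
Qed.

(* A minimiser of [sqrt (M - h y) + c * enorm (y - y0)] must be a maximiser of
   [h]: otherwise a short gradient step from it decreases this quantity, since
   the PL condition makes the slope of [sqrt (M - h y)] at least
   [sqrt (mu / 2)]. *)
Lemma PL_quadratic_growth (c : R) (y0 : 'rV[R]_d) :
  0 < c -> 2 * c ^+ 2 < mu ->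
  exists2 y, h y = M & c * enorm (y - y0) <= Num.sqrt (M - h y0).
Proof.
move=> c0 cmu.
pose phi y := Num.sqrt (M - h y) + c * enorm (y - y0).
have cphi : continuous phi.
  move=> y; apply: (@cvgD _ _ _ _ (nbhs_filter y)).
    exact: (cvg_comp _ _ (cvgB (cvg_cst M) (@ch y)) (@sqrt_continuous R _)).
  apply: (@cvgM _ _ _ (nbhs_filter y)); first exact: cvg_cst.
  exact: continuous_enormB.
have phi0 : phi y0 = Num.sqrt (M - h y0) by rewrite /phi subrr enorm0 mulr0 addr0.
(* Outside the ball of this radius the term [c * enorm (y - y0)] alone exceeds [phi y0], so a
   minimum over the compact ball is global. *)
set r := Num.sqrt (M - h y0) / c.
have [] := @compact_EVT_min _ R phi [set y | enorm (y - y0) <= r].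
- by exists y0 => /=; rewrite subrr enorm0 divr_ge0 ?sqrtr_ge0// ltW.
- exact: compact_eball.
- exact: continuous_subspaceT.
move=> y _ miny.
have {}miny z : phi y <= phi z.
  have [zr|zr] := leP (enorm (z - y0)) r; first by apply: miny; rewrite inE.
  have : phi y <= phi y0.
    by apply: miny; rewrite inE/= subrr enorm0 divr_ge0 ?sqrtr_ge0// ltW.
  move=> /le_trans; apply; rewrite phi0 /phi.
  rewrite /r ltr_pdivrMr// mulrC in zr.
  by rewrite (le_trans (ltW zr))// lerDr sqrtr_ge0.
exists y; last by rewrite -phi0 (le_trans _ (miny y0))// lerDr sqrtr_ge0.
apply/eqP; rewrite eq_le hM/= leNgt; apply/negP => yM.
pose q := 2 * c ^+ 2 / mu.
have q1 : q < 1 by rewrite ltr_pdivrMr// mul1r.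
have q0 : 0 < q by rewrite divr_gt0// mulr_gt0// exprn_gt0.
(* With this step length [1 - l * eta / 2 = (3 + q) / 4]. The estimates below force
   [((3 + q) / 4) ^+ 2 <= q], which fails for [q < 1] because left minus right is
   [(1 - q) * (9 - q) / 16]. *)
pose eta := (1 - q) / (2 * l).
have eta0 : 0 < eta by rewrite divr_gt0 ?subr_gt0 ?mulr_gt0.
have leta : l * eta = (1 - q) / 2 by rewrite /eta; field; rewrite gt_eqF.
pose N := enorm (gr y).
have PLy := PL y.
have lo := lower y (eta *: gr y).
rewrite dotZr -enorm_sqr enormZ (ger0_norm (ltW eta0)) -/N exprMn in lo.
rewrite -/N in PLy.
have phle := miny (y + eta *: gr y).
rewrite /phi in phle.
have tri : enorm (y + eta *: gr y - y0) <= enorm (y - y0) + eta * N.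
  by rewrite addrAC (le_trans (enormD _ _))// enormZ (ger0_norm (ltW eta0)).
have D0 : 0 <= M - h (y + eta *: gr y) by rewrite subr_ge0.
have sD := sqr_sqrtr D0; have sD0 := sqrtr_ge0 (M - h (y + eta *: gr y)).
have D1 : 0 <= M - h y by rewrite subr_ge0.
have sE := sqr_sqrtr D1; have sE0 := sqrtr_ge0 (M - h y).
set s := Num.sqrt (M - h y) in phle sE sE0.
set s' := Num.sqrt (M - h (y + _)) in phle sD sD0.
have ss' : s <= s' + c * (eta * N).
  by have := ler_wpM2l (ltW c0) tri; rewrite mulrDr; lra.
have N0 : 0 <= N := enorm_ge0 _.
have muD : 0 < mu * (M - h y) by rewrite mulr_gt0 ?subr_gt0.
have N2 : 0 < N ^+ 2 by lra.
have Np : 0 < N by rewrite lt0r N0 andbT -sqrf_eq0 gt_eqF.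
have k0 : 0 < 1 - l * eta / 2 by rewrite leta; lra.
have dec : eta * N ^+ 2 * (1 - l * eta / 2) <= s ^+ 2 - s' ^+ 2.
  by rewrite sD sE; move: lo; rewrite expr2; lra.
have dp : 0 < s ^+ 2 - s' ^+ 2.
  by apply: lt_le_trans dec; apply: mulr_gt0 => //; apply: mulr_gt0.
have ltss : s' < s by rewrite -(@ltr_pXn2r _ 2) ?nnegrE//; lra.
(* In the factorisation [(s - s') * (s + s')], minimality of [y] bounds the first factor by
   [c * (eta * N)] and [s' < s] bounds the second by [2 * s]. *)
have up : s ^+ 2 - s' ^+ 2 <= 2 * s * (c * (eta * N)).
  rewrite subr_sqr mulrC; apply: ler_pM; lra.
have key : N * (1 - l * eta / 2) <= 2 * s * c.
  have e : 0 < eta * N by rewrite mulr_gt0.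
  rewrite -(ler_pM2l e).
  by have := le_trans dec up; rewrite expr2; lra.
have key2 : (N * (1 - l * eta / 2)) ^+ 2 <= (2 * s * c) ^+ 2.
  by rewrite ler_pXn2r ?nnegrE ?mulr_ge0// ltW.
have {}key2 : N ^+ 2 * (1 - l * eta / 2) ^+ 2 <= 2 * q * (mu * s ^+ 2).
  move: key2; rewrite !exprMn /q => /le_trans; apply.
  rewrite le_eqVlt; apply/orP; left; apply/eqP; by field; rewrite gt_eqF.
have : N ^+ 2 * (1 - l * eta / 2) ^+ 2 <= N ^+ 2 * q.
  rewrite (le_trans key2)//.
  by rewrite -sE in PLy; have := ler_wpM2l (ltW q0) PLy; lra.
rewrite ler_pM2l// leta; nra.
Qed.

End QuadraticGrowth.

(** * The primal function [max_y f] *)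

Section Envelope.
Context {R : realType} {d1 d2 : nat}.
Variables (f : 'rV[R]_d1 -> 'rV[R]_d2 -> R).
Hypothesis hsaddle : saddle_point_existence f.

Lemma max_y_attained x : exists y, f x y = max_y f x.
Proof.
have [_ _ /(_ x)[y fy]] := hsaddle; exists y.
apply/eqP; rewrite eq_le; apply/andP; split.
  by apply: ub_le_sup; [exists (f x y) => _ [z _ <-]; exact: fy|exists y].
by apply: ge_sup; [exists (f x y), y|move=> _ [z _ <-]; exact: fy].
Qed.

Lemma le_max_y x y : f x y <= max_y f x.
Proof.
have [_ _ /(_ x)[z fz]] := hsaddle.
by apply: ub_le_sup; [exists (f x z) => _ [w _ <-]; exact: fz|exists y].
Qed.

Lemma has_lbound_max_y : has_lbound (range (max_y f)).
Proof.
have [[xs [ys fs]] _ _] := hsaddle; exists (f xs ys) => _ [x _ <-].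
by apply: le_trans (le_max_y x ys); have [] := fs x ys.
Qed.

Lemma min_max_le x : min_max f <= max_y f x.
Proof. by apply: ge_inf; [exact: has_lbound_max_y|exists x]. Qed.

(** Weak duality. At a maximiser [ys] of [f x] it turns the PL condition in [x] into a PL inequality
    for [max_y f], since [f x ys - min_x f ys] dominates [max_y f x - min_max f]. *)
Lemma min_x_le_min_max y : min_x f y <= min_max f.
Proof.
apply: lb_le_inf; first by exists (max_y f 0), 0.
move=> _ [x _ <-]; apply: le_trans (le_max_y x y).
have [_ /(_ y)[xs fxs] _] := hsaddle.
by apply: ge_inf; [exists (f xs y) => _ [z _ <-]; exact: fxs|exists x].
Qed.

Variables (l mu1 mu2 : R).
Hypotheses (hC1 : continuously_differentiable f) (hl : 0 < l).
Hypotheses (hlip : lipschitz_gradient f l) (hmu2 : 0 < mu2).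
Hypothesis hPL : two_sided_PL f mu1 mu2.

Lemma differentiable_x y x : differentiable (fun x' => f x' y) x.
Proof.
have [df _ _] := hC1.
apply: (@differentiable_comp _ _ _ _ (fun x' => (x', y)) (fun z => f z.1 z.2)) => //.
Qed.

Lemma differentiable_y x y : differentiable (fun y' => f x y') y.
Proof.
have [df _ _] := hC1.
apply: (@differentiable_comp _ _ _ _ (fun y' => (x, y')) (fun z => f z.1 z.2)) => //.
Qed.

Lemma descent_x x y v :
  `|f (x + v) y - f x y - dot (gradx f x y) v| <= l / 2 * enorm v ^+ 2.
Proof.
apply: (@descent _ _ (fun x => f x y)) => [z|z1 z2].
  exact: differentiable_x.
by have [] := hlip z1 z2 y y; rewrite subrr enorm0 addr0.
Qed.

Lemma descent_y x y v :
  `|f x (y + v) - f x y - dot (grady f x y) v| <= l / 2 * enorm v ^+ 2.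
Proof.
apply: (@descent _ _ (fun y => f x y)) => [z|z1 z2].
  exact: differentiable_y.
by have [] := hlip x x z1 z2; rewrite subrr enorm0 add0r.
Qed.

Lemma maximiser_near (c : R) x y0 : 0 < c -> 2 * c ^+ 2 < mu2 ->
  exists2 y, f x y = max_y f x &
    c * enorm (y - y0) <= Num.sqrt (max_y f x - f x y0).
Proof.
move=> c0 cmu.
apply: (@PL_quadratic_growth _ _ (f x) (grady f x) l mu2) => //.
- by move=> y; exact: (differentiable_continuous (differentiable_y x y)).
- by move=> y v; have := descent_y x y v; rewrite ler_norml => /andP[]; lra.
- exact: le_max_y.
- by move=> y; have [] := hPL x y.
Qed.

(** A step of length factor [l^-1] along the gradient raises [f x] by at least
    [enorm (grady f x y) ^+ 2 / (2 * l)], which a maximiser forbids. *)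
Lemma grady_maximiser x y : f x y = max_y f x -> grady f x y = 0.
Proof.
move=> fxy; apply: enorm0_eq0; apply/eqP; rewrite -sqrf_eq0 eq_le sqr_ge0 andbT.
have := descent_y x y (l^-1 *: grady f x y).
rewrite ler_norml => /andP[+ _].
have := le_max_y x (y + l^-1 *: grady f x y); rewrite -fxy.
rewrite dotZr -enorm_sqr enormZ gtr0_norm ?invr_gt0// exprMn.
have -> a : l / 2 * (l^-1 ^+ 2 * a) = l^-1 * a / 2 by field; rewrite gt_eqF.
move=> h1 h2; rewrite -(@pmulr_rle0 _ l^-1) ?invr_gt0//; lra.
Qed.

(** Since [grady f x y = 0], the gradient in [y] at [(x', y)] has norm at most [l * enorm (x' - x)].
    PL turns this into a bound on the gap [max_y f x' - f x' y], and quadratic growth turns the gap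
    into a distance. *)
Lemma maximiser_lipschitz (kappa : R) x x' y :
  l / mu2 < kappa -> f x y = max_y f x ->
  exists2 y', f x' y' = max_y f x' & enorm (y' - y) <= kappa * enorm (x' - x).
Proof.
move=> kl fxy.
have k0 : 0 < kappa by apply: lt_trans kl; rewrite divr_gt0.
have m2 : 0 < 2 * mu2 by rewrite mulr_gt0.
pose r := Num.sqrt (2 * mu2).
have r0 : 0 < r by rewrite sqrtr_gt0.
have rE : r ^+ 2 = 2 * mu2 by rewrite sqr_sqrtr// ltW.
(* With this constant the growth bound against [l * enorm (x' - x) / r] is the claim itself, and the
   side condition [2 * c ^+ 2 < mu2] amounts to [l / mu2 < kappa]. *)
have [||y' fy' yy'] := @maximiser_near (l / (kappa * r)) x' y.
- by rewrite !divr_gt0// mulr_gt0.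
- rewrite expr_div_n exprMn rE.
  have : l ^+ 2 < (kappa * mu2) ^+ 2.
    by rewrite ltr_pXn2r ?nnegrE ?(ltW hl)// ?mulr_ge0 ?ltW// -ltr_pdivrMr.
  rewrite mulrA ltr_pdivrMr ?mulr_gt0 ?exprn_gt0//; nra.
exists y' => //.
have : Num.sqrt (max_y f x' - f x' y) <= l * enorm (x' - x) / r.
  rewrite -(@ler_pXn2r _ 2) ?nnegrE ?sqrtr_ge0 ?divr_ge0 ?mulr_ge0 ?enorm_ge0
    ?(ltW hl) ?(ltW r0)//.
  rewrite sqr_sqrtr ?subr_ge0 ?le_max_y// expr_div_n rE.
  rewrite ler_pdivlMr// mulrC.
  have [_ /le_trans] := hPL x' y; apply.
  rewrite ler_pXn2r ?nnegrE ?enorm_ge0 ?mulr_ge0 ?enorm_ge0 ?(ltW hl)//.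
  have [_] := hlip x' x y y.
  by rewrite (grady_maximiser fxy) subr0 subrr enorm0 addr0.
move=> /(le_trans yy') {}yy'.
have lr : 0 < l / r by rewrite divr_gt0.
rewrite -(ler_pM2l lr).
rewrite -(ler_pM2l k0) in yy'.
move: yy'.
have -> a : kappa * (l / (kappa * r) * a) = l / r * a by field; rewrite !gt_eqF.
move=> /le_trans; apply; rewrite le_eqVlt; apply/orP; left; apply/eqP.
by field; rewrite gt_eqF.
Qed.

Lemma max_y_lower x y v : f x y = max_y f x ->
  max_y f x + dot (gradx f x y) v - l / 2 * enorm v ^+ 2 <= max_y f (x + v).
Proof.
move=> fxy; apply: le_trans (le_max_y _ y).
by have := descent_x x y v; rewrite ler_norml fxy => /andP[]; lra.
Qed.

(* Moving in [n] small steps and choosing each maximiser close to the previous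
   one makes the gradient at the maximisers Lipschitz along the segment, so that
   the second-order terms add up to an arithmetic series. *)
Lemma max_y_upper_step (kappa : R) x y e n :
  l / mu2 < kappa -> f x y = max_y f x ->
  exists2 y', f (x + n%:R *: e) y' = max_y f (x + n%:R *: e) &
    enorm (y' - y) <= kappa * n%:R * enorm e /\
    max_y f (x + n%:R *: e) <= max_y f x + n%:R * dot (gradx f x y) e
      + l * enorm e ^+ 2 * (n%:R ^+ 2 / 2 + kappa * n%:R * (n%:R + 1) / 2).
Proof.
move=> kl fxy.
have k0 : 0 < kappa by apply: lt_trans kl; rewrite divr_gt0.
elim: n => [|n [yn fyn [dyn IH]]].
  exists y; first by rewrite scale0r addr0.
  by rewrite scale0r addr0 subrr enorm0; split; lra.
set xn := x + n%:R *: e in fyn dyn IH *.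
have xS : x + n.+1%:R *: e = xn + e.
  by rewrite -natr1 scalerDl scale1r addrA.
rewrite xS.
have [y' fy' dy'] := @maximiser_lipschitz kappa xn (xn + e) yn kl fyn.
rewrite [xn + e]addrC addrK in dy'.
have dy : enorm (y' - y) <= kappa * n.+1%:R * enorm e.
  have -> : y' - y = (y' - yn) + (yn - y) by rewrite addrA subrK.
  by rewrite (le_trans (enormD _ _))// -natr1; lra.
exists y' => //; split => //.
(* The base point is the old [xn] but [y'] is the new maximiser: the left side is then exactly
   [max_y f (xn + e)], while [f xn y'] is at most [max_y f xn]. *)
have := descent_x xn y' e; rewrite ler_norml fy' => /andP[_].
have := le_max_y xn y'.
have : dot (gradx f xn y' - gradx f x y) e
       <= l * (n%:R + kappa * n.+1%:R) * enorm e ^+ 2.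
  apply: le_trans (cauchy_schwarz _ _) _.
  rewrite expr2 mulrA ler_wpM2r ?enorm_ge0//.
  have [/le_trans + _] := hlip xn x y' y; apply.
  rewrite -mulrA ler_pM2l// mulrDl lerD//.
  by rewrite /xn addrAC subrr add0r enormZ normr_nat.
(* The second-order cost of this step is [l * (n + kappa * (n + 1)) + l / 2] times [enorm e ^+ 2],
   which is the increment of the bracket in the statement. *)
rewrite dotDl dotNl -natr1.
have := dot_ge0 e; rewrite -enorm_sqr => e0.
move: IH; set E := enorm e ^+ 2; set K := (n%:R : R); set D := dot _ e; set D' := dot _ e.
nra.
Qed.

Lemma max_y_upper x y v : f x y = max_y f x ->
  max_y f (x + v) <= max_y f x + dot (gradx f x y) v
    + (l + l ^+ 2 / mu2) / 2 * enorm v ^+ 2.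
Proof.
move=> fxy.
have [->|v0] := eqVneq v 0; first by rewrite addr0 dot0r enorm0; lra.
have E0 : 0 < enorm v ^+ 2.
  rewrite exprn_gt0// lt0r enorm_ge0 andbT.
  by apply: contra_neq v0 => /enorm0_eq0.
apply/ler_addgt0Pr => eps eps0.
(* The excess [s] is shared equally between [kappa - l / mu2] and [kappa / n]; its total
   contribution [l * enorm v ^+ 2 * s / 2] is [eps]. *)
pose s := 2 * eps / (l * enorm v ^+ 2).
have s0 : 0 < s by apply: divr_gt0; apply: mulr_gt0.
have sE : s * (l * enorm v ^+ 2) = 2 * eps by rewrite divfK// gt_eqF//; apply: mulr_gt0.
pose kappa := l / mu2 + s / 2.
have k0 : 0 < kappa by apply: addr_gt0; apply: divr_gt0.
pose n := Num.bound (2 * kappa / s).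
have nk : 2 * kappa / s < n%:R.
  apply: archi_boundP; rewrite ltW//; apply: divr_gt0 => //.
  exact: mulr_gt0.
have n0 : (0 : R) < n%:R by apply: lt_trans nk; apply: divr_gt0 => //; apply: mulr_gt0.
have [|_ _ [_]] := @max_y_upper_step kappa x y (n%:R^-1 *: v) n _ fxy.
  by rewrite ltrDl; apply: divr_gt0.
rewrite scalerA mulfV ?gt_eqF// scale1r => /le_trans; apply.
rewrite dotZr enormZ exprMn mulVKf ?gt_eqF// gtr0_norm ?invr_gt0//.
set E := enorm v ^+ 2 in E0 sE *.
have -> : l * (n%:R^-1 ^+ 2 * E) *
    (n%:R ^+ 2 / 2 + kappa * n%:R * (n%:R + 1) / 2) =
    l * E * (1 + kappa + kappa / n%:R) / 2 by field; rewrite gt_eqF.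
have {}nk : kappa / n%:R <= s / 2.
  by rewrite ler_pdivrMr//; move: nk; rewrite ltr_pdivrMr//;
     move: (n%:R : R) {k0 n0} => m; lra.
have := ler_wpM2l (ltW (mulr_gt0 hl E0)) nk.
rewrite expr2 -(mulrA l l); move: (kappa / n%:R) => q; rewrite /kappa.
move: (l / mu2) => k1; lra.
Qed.

(** The one-sided bounds at a maximiser supply a modulus of continuity; continuity in turn makes
    this supremum over an uncountable family Borel. *)
Lemma continuous_max_y : continuous (max_y f).
Proof.
move=> x; have [y fxy] := max_y_attained x.
set a := gradx f x y; set C := (l + l ^+ 2 / mu2 + l) / 2.
have C0 : 0 <= C.
  by rewrite divr_ge0// ltW// !addr_gt0// divr_gt0// exprn_gt0.
pose k x' := enorm a * enorm (x' - x) + C * enorm (x' - x) ^+ 2.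
have kx : k x' @[x' --> x] --> (0 : R).
  have -> : (0 : R) = k x by rewrite /k subrr enorm0; ring.
  have ce := @continuous_enormB R d1 x x.
  apply: (@cvgD _ _ _ _ (nbhs_filter x)).
    by apply: (@cvgM _ _ _ (nbhs_filter x)) => //; exact: cvg_cst.
  apply: (@cvgM _ _ _ (nbhs_filter x)) => //; first exact: cvg_cst.
  exact: (cvg_comp _ _ ce (@exprn_continuous R 2 _)).
have dk x' : `|max_y f x - max_y f x'| <= k x'.
  have lo := max_y_lower (x' - x) fxy; have up := max_y_upper (x' - x) fxy.
  rewrite [x + _]addrC subrK -/a in lo up.
  have h1 := cauchy_schwarz a (x' - x).
  have h2 := cauchy_schwarz (- a) (x' - x); rewrite dotNl enormN in h2.
  have e0 := sqr_ge0 (enorm (x' - x)).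
  have h3 : 0 <= l * enorm (x' - x) ^+ 2 by rewrite mulr_ge0// ltW.
  have h4 : 0 <= l ^+ 2 / mu2 * enorm (x' - x) ^+ 2.
    by rewrite mulr_ge0// divr_ge0 ?sqr_ge0// ltW.
  rewrite ler_norml /k /C; apply/andP; split; lra.
apply/(@cvgrPdist_le _ _ _ _ (nbhs_filter x)) => e e0.
have /(@cvgrPdist_le _ _ _ _ (nbhs_filter x)) /(_ e e0) := kx.
apply: filterS => x'; rewrite sub0r normrN; apply: le_trans.
by rewrite (le_trans (dk x'))// ler_norm.
Qed.

End Envelope.

(** * One step of the algorithm in conditional expectation *)

Section Noise.
Context {R : realType} {dXi : measure_display} {Xi : measurableType dXi}.
Variables (P : probability Xi R) (d : nat).
Variables (G : Xi -> 'rV[R]_d) (v : 'rV[R]_d) (sigma : R).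
Hypothesis mG : forall i, measurable_fun [set: Xi] (fun xi => G xi 0 i).
Hypothesis EG : forall i, ('E_P[fun xi => (G xi 0 i)%R] = (v 0 i)%:E)%E.
Hypothesis VG :
  ('E_P[(fun xi => enorm (G xi - v) ^+ 2)%R] <= (sigma ^+ 2)%:E)%E.

Lemma measurable_coord_noise i :
  measurable_fun [set: Xi] (fun xi => (G xi - v) 0 i).
Proof.
rewrite (_ : (fun _ => _) = (fun xi => G xi 0 i - v 0 i)).
  by apply: measurable_funB => //; exact: measurable_cst.
by apply/funext => xi; rewrite !mxE.
Qed.

Lemma integrable_estimator i : P.-integrable setT (EFin \o (fun xi => G xi 0 i)).
Proof.
have := EG i; rewrite unlock => E.
apply/integrableP; split; first exact/measurable_EFinP.
by rewrite integral_fin_num_abs//= E.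
Qed.

Lemma measurable_enorm_noise :
  measurable_fun [set: Xi] (fun xi => enorm (G xi - v) ^+ 2).
Proof.
under eq_fun do rewrite enorm_sqr.
apply: measurable_sum => i; apply: measurable_funM; exact: measurable_coord_noise.
Qed.

Lemma integrable_noise_sqr :
  P.-integrable setT (EFin \o (fun xi => enorm (G xi - v) ^+ 2)).
Proof.
apply/integrableP; split; first exact/measurable_EFinP/measurable_enorm_noise.
rewrite (eq_integral (EFin \o (fun xi => enorm (G xi - v) ^+ 2))).
  by move: VG; rewrite unlock => /le_lt_trans; apply; rewrite ltry.
by move=> xi _; rewrite /= ger0_norm// sqr_ge0.
Qed.

Lemma integral_noise i : (\int[P]_xi ((G xi - v) 0 i)%:E = 0)%E.
Proof.
under eq_integral do rewrite !mxE EFinB.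
rewrite integralB//=; first last.
- exact: finite_measure_integrable_cst.
- exact: integrable_estimator.
have := EG i; rewrite unlock => ->.
by rewrite integral_cst//= probability_setT mule1 subee.
Qed.

Lemma integrable_noise i : P.-integrable setT (fun xi => ((G xi - v) 0 i)%:E).
Proof.
rewrite (_ : (fun _ => _) =
    ((EFin \o (fun xi => (G xi 0 i)%R)) \- cst (v 0 i)%R%:E)%E).
  apply: integrableB => //; first exact: integrable_estimator.
  exact: finite_measure_integrable_cst.
by apply/funext => xi; rewrite /= !mxE EFinB.
Qed.

(** Unbiasedness kills the linear term and the variance bound controls the quadratic one.
    Nonnegativity of [phi] allows comparison of integrals before anything is known of the
    integrability of [phi]. *)
Lemma integral_le_quadratic (phi : Xi -> R) (c k : R) (u : 'rV[R]_d) :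
  measurable_fun [set: Xi] phi -> (forall xi, 0 <= phi xi) -> 0 <= k ->
  (forall xi, phi xi <= c + dot u (G xi - v) + k * enorm (G xi - v) ^+ 2) ->
  (\int[P]_xi (phi xi)%:E <= (c + k * sigma ^+ 2)%:E)%E.
Proof.
move=> mphi phi0 k0 phile.
pose H xi := ((cst c xi)%:E + \sum_(i < d) (u 0 i)%R%:E * ((G xi - v) 0 i)%R%:E
             + k%:E * (enorm (G xi - v) ^+ 2)%R%:E)%E.
have HE xi : H xi = (c + dot u (G xi - v) + k * enorm (G xi - v) ^+ 2)%:E.
  rewrite /H /dot !EFinD EFinM; congr (_ + _ + _)%E.
  by rewrite -sumEFin.
have i1 : P.-integrable setT (EFin \o cst c).
  exact: finite_measure_integrable_cst.
have i2 i : P.-integrable setT (fun xi => (u 0 i)%R%:E * ((G xi - v) 0 i)%R%:E)%E.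
  by apply: integrableZl => //; exact: integrable_noise.
have i2s : P.-integrable setT
    (fun xi => \sum_(i < d) (u 0 i)%R%:E * ((G xi - v) 0 i)%R%:E)%E.
  by apply: integrable_sum => // i _; exact: i2.
have i3 : P.-integrable setT (fun xi => k%:E * (enorm (G xi - v) ^+ 2)%R%:E)%E.
  by apply: integrableZl => //; exact: integrable_noise_sqr.
have i12 := integrableD measurableT i1 i2s.
have iH : P.-integrable setT H by exact: (integrableD measurableT i12 i3).
apply: (@le_trans _ _ (\int[P]_xi H xi)%E).
  apply: ge0_le_integral => //.
  - by move=> xi _; rewrite lee_fin.
  - exact/measurable_EFinP.
  - exact: (measurable_int _ iH).
  - by move=> xi _; rewrite HE lee_fin.
rewrite /H (integralD measurableT i12 i3) (integralD measurableT i1 i2s).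
have -> : (\int[P]_x (EFin \o cst c) x = c%:E)%E.
  by rewrite [LHS](integral_cst P measurableT c%:E) /= probability_setT mule1.
rewrite integral_sum//.
rewrite big1 => [|i _]; last first.
  by rewrite integralZl//; [rewrite integral_noise mule0|exact: integrable_noise].
rewrite adde0 integralZl//; last exact: integrable_noise_sqr.
rewrite EFinD EFinM leeD2l//; apply: lee_wpmul2l; first by rewrite lee_fin.
by move: VG; rewrite unlock.
Qed.

End Noise.

(* [A] and [B] stand for the primal and dual gaps at [(x, y)], [G] and [F] for
   the squared norms of the gradient of [max_y f] at [x] and of [gradx f x y],
   and [D] for the squared norm of their difference. *)
Lemma contraction_arith {R : realType} (l mu1 mu2 tau1 tau2 q A B G F D : R) :
  0 < l -> 0 < mu1 -> 0 < mu2 -> mu1 <= l -> mu2 <= l ->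
  0 < tau2 <= 1 / l -> 0 < tau1 <= mu2 ^+ 2 * tau2 / (18 * l ^+ 2) ->
  0 <= A -> 0 <= B -> 0 <= G -> 0 <= D -> 0 <= F ->
  F <= 2 * G + 2 * D -> 2 * mu1 * A <= G -> 9 * mu2 * D <= 20 * l ^+ 2 * B ->
  q = 1 - mu2 * tau2 ->
  A + q * B / 10
  + (1 + q / 10) * ((D - F - G) / 2 * tau1 + (l + l ^+ 2 / mu2) / 2 * tau1 ^+ 2 * F)
  + q / 10 * (tau1 + l / 2 * tau1 ^+ 2) * F
  <= (1 - 1 / 2 * mu1 * tau1) * (A + B / 10).
Proof.
move=> l0 m10 m20 m1l m2l /andP[t20 t2] /andP[t10 t1] A0 B0 G0 D0 F0 FGD AG DB qE.
have l20 : 0 < l ^+ 2 by rewrite exprn_gt0.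
pose s := mu2 * tau2.
have s0 : 0 < s by rewrite mulr_gt0.
have s1 : s <= 1.
  by move: t2; rewrite ler_pdivlMr// => t2; rewrite (le_trans _ t2)// /s mulrC ler_pM2l.
have t1s : 18 * l ^+ 2 * tau1 <= mu2 * s.
  by move: t1; rewrite ler_pdivlMr ?mulr_gt0// /s; lra.
have lt : 18 * l * tau1 <= s.
  rewrite -(ler_pM2l l0); apply: (@le_trans _ _ (mu2 * s)).
    by move: t1s; rewrite expr2; lra.
  by rewrite ler_pM2r.
have mt : 18 * mu1 * tau1 <= s.
  apply: le_trans lt; rewrite ler_pM2r// ler_pM2l//.
have Lt : (l + l ^+ 2 / mu2) * tau1 <= 1 / 9.
  have : l ^+ 2 / mu2 * tau1 <= s / 18.
    rewrite mulrAC ler_pdivrMr//; lra.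
  rewrite mulrDl; lra.
rewrite -/s in qE.
have q0 : 0 <= q by rewrite qE; lra.
have q1 : q <= 1 by rewrite qE; lra.
have tD : 18 * (tau1 * D) <= s * (20 / 9 * B).
  have h : 18 * l ^+ 2 * tau1 * D <= mu2 * s * D by rewrite ler_wpM2r.
  have h2 := ler_wpM2l (ltW s0) DB.
  by rewrite -(ler_pM2l l20); lra.
have tG : mu1 * tau1 * A <= tau1 * G / 2.
  by have := ler_wpM2l (ltW t10) AG; lra.
have tB : mu1 * tau1 * B <= s * B / 18.
  by have := ler_wpM2r B0 mt; lra.
have tF : tau1 * F <= 2 * (tau1 * G) + 2 * (tau1 * D).
  by have := ler_wpM2l (ltW t10) FGD; lra.
have tF0 : 0 <= tau1 * F by rewrite mulr_ge0// ltW.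
have tG0 : 0 <= tau1 * G by rewrite mulr_ge0// ltW.
have tD0 : 0 <= tau1 * D by rewrite mulr_ge0// ltW.
have lF : l * tau1 ^+ 2 * F <= tau1 * F / 18.
  have : l * tau1 <= 1 / 18 by lra.
  by move=> /(ler_wpM2r tF0); rewrite expr2; lra.
have LF : (l + l ^+ 2 / mu2) * tau1 ^+ 2 * F <= tau1 * F.
  have : (l + l ^+ 2 / mu2) * tau1 <= 1 by lra.
  by move=> /(ler_wpM2r tF0); rewrite expr2; lra.
(* Since [L * tau1 <= 1], the [- F / 2] of the first-order term absorbs the second-order term. *)
have e1 : (1 + q / 10) * ((D - F - G) / 2 * tau1 + (l + l ^+ 2 / mu2) / 2 * tau1 ^+ 2 * F)
       <= (1 + q / 10) * ((tau1 * D - tau1 * G) / 2).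
  by rewrite ler_pM2l; lra.
have e2 : q / 10 * (tau1 + l / 2 * tau1 ^+ 2) * F <=
   q / 10 * (37 / 36 * (2 * (tau1 * G) + 2 * (tau1 * D))).
  rewrite -mulrA ler_wpM2l//; lra.
clear FGD AG DB t1 t1s lF LF F0 tF tF0 Lt.
set X := (1 + q / 10) * _ in e1 *; set Y := q / 10 * _ * _ in e2 *.
have sB : 0 <= s * B by rewrite mulr_ge0// ltW.
have qG : q * (tau1 * G) <= tau1 * G by rewrite ler_piMl.
have qD : q * (tau1 * D) <= tau1 * D by rewrite ler_piMl.
(* The budget: the [tau1 * D] terms have total coefficient at most 34/45 and [tau1 * D] is at most
   10/81 of [s * B], so with the 1/360 from [tB] they stay below the gain [s * B / 10]. The
   [tau1 * G] terms have coefficient at most -31/90, which covers the 1/4 needed for [A]. *)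
have qB : q * B = B - s * B by rewrite qE; ring.
have qG0 : 0 <= q * (tau1 * G) by rewrite mulr_ge0.
lra.
Qed.

Section ConditionalStep.
Context {R : realType} {d1 d2 : nat}.
Variables (f : 'rV[R]_d1 -> 'rV[R]_d2 -> R) (l mu1 mu2 : R).
Hypotheses (hC1 : continuously_differentiable f) (hl : 0 < l).
Hypotheses (hlip : lipschitz_gradient f l) (hsaddle : saddle_point_existence f).
Hypotheses (hmu1 : 0 < mu1) (hmu2 : 0 < mu2) (hPL : two_sided_PL f mu1 mu2).
Hypotheses (hmu1l : mu1 <= l) (hmu2l : mu2 <= l).
Context {dXi : measure_display} {Xi : measurableType dXi}.
Variables (P : probability Xi R) (sigma tau1 tau2 : R).
Hypothesis htau2 : 0 < tau2 <= 1 / l.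
Hypothesis htau1 : 0 < tau1 <= mu2 ^+ 2 * tau2 / (18 * l ^+ 2).

Definition lyapunov x y : R :=
  max_y f x - min_max f + 1 / 10 * (max_y f x - f x y).

(* Bound on the expectation of [lyapunov x (y + tau2 *: Gy x y xi)]. *)
Definition lyapunov_mid x y : R :=
  max_y f x - min_max f
  + 1 / 10 * ((1 - mu2 * tau2) * (max_y f x - f x y)
              + l / 2 * tau2 ^+ 2 * sigma ^+ 2).

Lemma mu2_tau2_le1 : mu2 * tau2 <= 1.
Proof.
move: htau2 => /andP[t0]; rewrite ler_pdivlMr// => t1.
by rewrite (le_trans _ t1)// mulrC ler_pM2l.
Qed.

Lemma lyapunov_ge0 x y : 0 <= lyapunov x y.
Proof.
have := min_max_le hsaddle x; have := le_max_y hsaddle x y.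
by rewrite /lyapunov; lra.
Qed.

Lemma lyapunov_mid_ge0 x y : 0 <= lyapunov_mid x y.
Proof.
have h := min_max_le hsaddle x; have h2 := le_max_y hsaddle x y.
have h3 := mu2_tau2_le1.
have h4 : 0 <= (1 - mu2 * tau2) * (max_y f x - f x y).
  by rewrite mulr_ge0 ?subr_ge0.
have h5 : 0 <= l * (tau2 ^+ 2 * sigma ^+ 2).
  by apply: mulr_ge0; [exact: ltW|apply: mulr_ge0; exact: sqr_ge0].
rewrite /lyapunov_mid; lra.
Qed.

(** With [x] frozen, the mean increase of [f x] is at least
    [tau2 * (1 - l / 2 * tau2) * enorm v ^+ 2] up to noise. As [l * tau2 <= 1] this is at least half
    of [tau2 * enorm v ^+ 2], and PL makes it a fraction [mu2 * tau2] of the dual gap. *)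
Lemma expected_dual_step (G : Xi -> 'rV[R]_d2) x y :
  (forall i, measurable_fun [set: Xi] (fun xi => G xi 0 i)) ->
  (forall i, ('E_P[fun xi => (G xi 0 i)%R] = (grady f x y 0 i)%R%:E)%E) ->
  ('E_P[(fun xi => enorm (G xi - grady f x y) ^+ 2)%R] <= (sigma ^+ 2)%:E)%E ->
  measurable_fun [set: Xi] (fun xi => lyapunov x (y + tau2 *: G xi)) ->
  (\int[P]_xi (lyapunov x (y + tau2 *: G xi))%:E <= (lyapunov_mid x y)%:E)%E.
Proof.
move=> mG EG VG mV.
move: htau2 => /andP[t20 t21].
set v := grady f x y in EG VG.
pose c := max_y f x - min_max f + 1 / 10 * (max_y f x - f x y
  - tau2 * (1 - l / 2 * tau2) * enorm v ^+ 2).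
pose k := 1 / 10 * (l / 2 * tau2 ^+ 2).
pose u := (1 / 10 * (l * tau2 ^+ 2 - tau2)) *: v.
apply: (@le_trans _ _ (c + k * sigma ^+ 2)%:E).
  apply: (integral_le_quadratic mG EG VG (u := u)) => //.
  - by move=> xi; exact: lyapunov_ge0.
  - apply: mulr_ge0; first by rewrite divr_ge0.
    by apply: mulr_ge0; [rewrite divr_ge0// ltW|exact: sqr_ge0].
  - move=> xi; rewrite /lyapunov.
    have := descent_y hC1 hlip x y (tau2 *: G xi).
    rewrite ler_norml => /andP[+ _].
    rewrite -/v; set w := G xi - v.
    have -> : G xi = v + w by rewrite /w addrC subrK.
    clearbody w.
    rewrite /c /k /u !enorm_sqr !dotE (dotC w v); lra.
rewrite lee_fin /c /k /lyapunov_mid.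
have [_ PLy] := hPL x y; rewrite -/v in PLy.
have lt : l * tau2 <= 1 by move: t21; rewrite ler_pdivlMr// mulrC.
have n0 := sqr_ge0 (enorm v).
have h1 : tau2 * (1 / 2 * enorm v ^+ 2) <= tau2 * ((1 - l / 2 * tau2) * enorm v ^+ 2).
  by rewrite ler_pM2l// ler_wpM2r//; lra.
have := ler_wpM2l (ltW t20) PLy; lra.
Qed.

(** In [lyapunov_mid] the function [max_y f] has weight [1 + q / 10] and [f] at the old [y] has
    weight [- q / 10], so an upper bound for the former and a lower bound for the latter are
    combined. Their slopes [a] and [b] are compared through a maximiser [ys] close to [y]. *)
Lemma expected_primal_step (G : Xi -> 'rV[R]_d1) x y :
  (forall i, measurable_fun [set: Xi] (fun xi => G xi 0 i)) ->
  (forall i, ('E_P[fun xi => (G xi 0 i)%R] = (gradx f x y 0 i)%R%:E)%E) ->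
  ('E_P[(fun xi => enorm (G xi - gradx f x y) ^+ 2)%R] <= (sigma ^+ 2)%:E)%E ->
  measurable_fun [set: Xi] (fun xi => lyapunov_mid (x - tau1 *: G xi) y) ->
  (\int[P]_xi (lyapunov_mid (x - tau1 *: G xi) y)%:E <=
    ((1 - 1 / 2 * mu1 * tau1) * lyapunov x y
     + ((1 - mu2 * tau2) * (l + l ^+ 2 / mu2 + l) * tau1 ^+ 2 + l * tau2 ^+ 2
        + 10 * (l + l ^+ 2 / mu2) * tau1 ^+ 2) / 20 * sigma ^+ 2)%:E)%E.
Proof.
move=> mG EG VG mV.
set b := gradx f x y in EG VG.
set L := l + l ^+ 2 / mu2.
set q := 1 - mu2 * tau2.
have q0 : 0 <= q by rewrite subr_ge0 mu2_tau2_le1.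
have t10 : 0 < tau1 by case/andP: htau1.
have L0 : 0 < L by rewrite addr_gt0// divr_gt0// exprn_gt0.
(* Any [c ^+ 2 < mu2 / 2] is allowed here; 9 / 20 leaves room in
   [contraction_arith]. *)
pose c := Num.sqrt (9 / 20 * mu2).
have c0 : 0 < c by rewrite sqrtr_gt0 mulr_gt0// divr_gt0.
have cE : c ^+ 2 = 9 / 20 * mu2 by rewrite sqr_sqrtr// mulr_ge0 ?divr_ge0// ltW.
have [|ys fys dys] := maximiser_near hsaddle hC1 hl hlip hmu2 hPL x y c0.
  by rewrite cE; move: hmu2; lra.
set a := gradx f x ys.
set A := max_y f x - min_max f.
set B := max_y f x - f x y.
have A0 : 0 <= A by rewrite subr_ge0 min_max_le.
have B0 : 0 <= B by rewrite subr_ge0 le_max_y.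
have D_le : 9 * mu2 * enorm (b - a) ^+ 2 <= 20 * l ^+ 2 * B.
  have : enorm (b - a) <= l * enorm (ys - y).
    have [/le_trans + _] := hlip x x y ys; apply.
    by rewrite subrr enorm0 add0r -(enormN (y - ys)) opprB.
  rewrite -(@ler_pXn2r _ 2) ?nnegrE ?mulr_ge0 ?enorm_ge0 ?(ltW hl)// => ba.
  move: dys; rewrite -(@ler_pXn2r _ 2) ?nnegrE ?mulr_ge0 ?enorm_ge0 ?sqrtr_ge0
    ?(ltW c0)//.
  rewrite sqr_sqrtr// exprMn cE => dys.
  have := ler_wpM2l (ltW hmu2) ba; rewrite exprMn.
  by have := ler_wpM2l (sqr_ge0 l) dys; rewrite -/B; lra.
have G_ge : 2 * mu1 * A <= enorm a ^+ 2.
  have [PLx _] := hPL x ys; apply: le_trans PLx.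
  rewrite ler_pM2l ?mulr_gt0// fys lerD2l lerN2.
  exact: min_x_le_min_max.
have := contraction_arith (F := enorm b ^+ 2) hl hmu1 hmu2 hmu1l hmu2l htau2 htau1 A0 B0
  (sqr_ge0 (enorm a)) (sqr_ge0 (enorm (b - a))) (sqr_ge0 _) _ G_ge D_le (erefl q).
have FGD : enorm b ^+ 2 <= 2 * enorm a ^+ 2 + 2 * enorm (b - a) ^+ 2.
  have := enormB_sqr_le a (- (b - a)).
  by rewrite opprK addrC subrK enormN.
move=> /(_ FGD) {FGD D_le G_ge} main.
pose c' := A + q * B / 10
  + (1 + q / 10) * (- tau1 * dot a b + L / 2 * tau1 ^+ 2 * enorm b ^+ 2)
  + q / 10 * (tau1 + l / 2 * tau1 ^+ 2) * enorm b ^+ 2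
  + 1 / 20 * l * tau2 ^+ 2 * sigma ^+ 2.
pose k := ((1 + q / 10) * L + q / 10 * l) / 2 * tau1 ^+ 2.
pose u := (1 + q / 10) *: (- tau1 *: a + (L * tau1 ^+ 2) *: b)
          + (q / 10 * (tau1 + l * tau1 ^+ 2)) *: b.
apply: (@le_trans _ _ (c' + k * sigma ^+ 2)%:E).
  apply: (integral_le_quadratic mG EG VG (u := u)) => //.
  - by move=> xi; exact: lyapunov_mid_ge0.
  - have q10 : 0 <= q / 10 by rewrite divr_ge0.
    rewrite mulr_ge0 ?sqr_ge0// divr_ge0// addr_ge0// mulr_ge0//.
    + by rewrite addr_ge0.
    + exact: ltW.
    + exact: ltW.
  - move=> xi; rewrite /lyapunov_mid -/q.
    have := descent_x hC1 hlip x y (- (tau1 *: G xi)).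
    have := max_y_upper hsaddle hC1 hl hlip hmu2 hPL (- (tau1 *: G xi)) fys.
    rewrite -/a -/b -/L ler_norml => up /andP[lo _]; move: up lo.
    set w := G xi - b.
    have -> : G xi = b + w by rewrite /w addrC subrK.
    clearbody w; rewrite enormN.
    set gx := max_y f (x - _); set fx := f (x - _) y => up lo.
    have q10 : 0 <= q / 10 by rewrite divr_ge0.
    have q11 : 0 <= 1 + q / 10 by rewrite addr_ge0.
    have := ler_wpM2l q11 up; have := ler_wpM2l q10 lo.
    rewrite /c' /k /u !enorm_sqr !dotE (dotC w b) /A /B.
    clear up lo main q0 q10 q11 c' k u A0 B0 A B.
    by clearbody gx fx q L; lra.
rewrite lee_fin /c' /k /lyapunov -/A -/B; move: main.
(* Polarisation: the [(D - F - G) / 2] of [contraction_arith] is [- dot a b], the mean first-order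
   change of [max_y f] per unit of [tau1]. *)
have -> : enorm (b - a) ^+ 2 = enorm b ^+ 2 + enorm a ^+ 2 - 2 * dot a b.
  by rewrite !enorm_sqr !dotE (dotC b a); ring.
rewrite -/L; lra.
Qed.

End ConditionalStep.

(** * Borel measurability *)

Section BorelVectors.
Context {R : realType}.

Lemma continuous_measurable_rV d (h : 'rV[R]_d -> R) :
  continuous h -> measurable_fun [set: borel_rV R d] h.
Proof.
move=> ch.
apply: (measurability _ (RGenOInfty.measurableE R)) => _ [_ [a ->] <-].
rewrite setTI; apply: sub_sigma_algebra; exact: open_comp.
Qed.

Lemma measurable_coord d (i : 'I_d) :
  measurable_fun [set: borel_rV R d] (fun x : borel_rV R d => x 0 i : R).
Proof.
apply: (@continuous_measurable_rV d (fun x => x 0 i)) => x.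
exact: coord_continuous.
Qed.

(** A countable base of cubes, open in the sup norm, with rational centres; the radius uses [q.2.+1]
    to stay positive and finite for every index. *)
Definition rat_box d (q : 'rV[rat]_d * nat) : set 'rV[R]_d :=
  [set x | forall i, `|x 0 i - ratr (q.1 0 i)| < q.2.+1%:R^-1].

Lemma open_bigcup_rat_box d (O : set 'rV[R]_d) : open O ->
  O = \bigcup_(q in [set q | rat_box q `<=` O]) rat_box q.
Proof.
move=> oO; apply/seteqP; split => [x Ox|x [q qO qx]]; last exact: qO.
have [e /= e0 xeO] : nbhs_ball x O by apply/nbhs_ballP; exact: open_nbhs_nbhs.
pose n := Num.truncn (2 / e).
have ne : n.+1%:R^-1 < e / 2.
  rewrite -[e / 2]invrK ltf_pV2 ?posrE ?invr_gt0 ?divr_gt0//.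
  by rewrite invf_div truncnS_gt.
have /choice[q qx] : forall i : 'I_d, exists q : rat,
    `|x 0 i - ratr q| < n.+1%:R^-1.
  move=> i.
  have [q] : exists q : rat, ratr q \in `]x 0 i - n.+1%:R^-1, x 0 i + n.+1%:R^-1[.
    by apply: rat_in_itvoo; rewrite ltrD2l gtrN// invr_gt0 ltr0n.
  rewrite in_itv/= => qx; exists q; rewrite distrC ltr_distl//.
exists (\row_i q i, n) => [y /= yq|i /=]; last by rewrite mxE.
apply: xeO; split => // k i; rewrite (ord1 k).
have := yq i; rewrite mxE => yqi.
rewrite /ball/= -(subrK (ratr (q i)) (x 0 i)) -addrA.
rewrite (le_lt_trans (ler_normD _ _))// (splitr e) ltrD//.
  exact: lt_trans (qx i) ne.
by rewrite distrC; exact: lt_trans yqi ne.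
Qed.

(** Open sets are countable unions of rational cubes, and the preimage of a cube is a finite
    intersection of preimages under coordinates. *)
Lemma measurable_fun_rV {dT} {T : measurableType dT} d (h : T -> 'rV[R]_d) :
  (forall i, measurable_fun [set: T] (fun t => h t 0 i)) ->
  measurable_fun [set: T] (h : T -> borel_rV R d).
Proof.
move=> mh; apply: (@measurability _ _ T (borel_rV R d) setT h open) => //.
move=> _ [V oV <-]; rewrite setTI (open_bigcup_rat_box oV) preimage_bigcup.
rewrite bigcup_mkcond; apply: countable_bigcupT_measurable => [|q].
  exact: countableP.
case: ifPn => _ //.
rewrite (_ : _ @^-1` _ = \bigcap_(i : 'I_d)
    (fun t => h t 0 i) @^-1` ball (ratr (q.1 0 i) : R) (q.2.+1%:R^-1)).
  apply: fin_bigcap_measurable => // i _.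
  rewrite -[X in measurable X]setTI; apply: mh => //.
  exact: measurable_ball.
apply/seteqP; split => t /= ht i.
  by move=> _; rewrite /ball/= distrC; exact: ht.
by have := ht i Logic.I; rewrite /ball/= distrC.
Qed.

Lemma continuous_row_split d1 d2 :
  continuous (fun x : 'rV[R]_(d1 + d2) => (lsubmx x, rsubmx x)).
Proof.
move=> x.
have cl : lsubmx (y : 'rV[R]_(d1 + d2)) @[y --> x] --> lsubmx x.
  move=> A /nbhs_ballP[e /= e0 eA]; apply/nbhs_ballP; exists e => // y [_ xy].
  by apply: eA; split => // k i; rewrite !mxE; exact: xy.
have cr : rsubmx (y : 'rV[R]_(d1 + d2)) @[y --> x] --> rsubmx x.
  move=> A /nbhs_ballP[e /= e0 eA]; apply/nbhs_ballP; exists e => // y [_ xy].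
  by apply: eA; split => // k i; rewrite !mxE; exact: xy.
exact: (cvg_pair cl cr).
Qed.

(** The domain carries the product of two Borel sigma-algebras, whereas continuity refers to the
    product topology. The two are reconciled by factoring through row vectors of length [d1 + d2],
    where measurability can be checked by coordinates. *)
Lemma continuous_measurable_rV2 d1 d2 (h : 'rV[R]_d1 -> 'rV[R]_d2 -> R) :
  continuous (fun z : 'rV[R]_d1 * 'rV[R]_d2 => h z.1 z.2) ->
  measurable_fun [set: borel_rV R d1 * borel_rV R d2]
    (fun z : borel_rV R d1 * borel_rV R d2 => h z.1 z.2).
Proof.
move=> ch.
pose k (x : 'rV[R]_(d1 + d2)) := h (lsubmx x) (rsubmx x).
have ck : continuous k.
  move=> x; exact: (cvg_comp _ _ (@continuous_row_split d1 d2 x) (ch _)).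
pose r (z : borel_rV R d1 * borel_rV R d2) : borel_rV R (d1 + d2) :=
  row_mx (z.1 : 'rV[R]_d1) (z.2 : 'rV[R]_d2).
rewrite (_ : (fun _ => _) = k \o r); last first.
  by apply/funext => z; rewrite /k /r /= row_mxKl row_mxKr.
apply: measurableT_comp; first exact: continuous_measurable_rV.
apply: measurable_fun_rV => i.
case: (splitP i) => j ij.
  rewrite (_ : (fun _ => _) = (fun x : borel_rV R d1 => x 0 j) \o fst).
    by apply: measurableT_comp; [exact: measurable_coord|exact: measurable_fst].
  apply/funext => z /=; rewrite /r (_ : i = lshift d2 j) ?row_mxEl//.
  exact: val_inj.
rewrite (_ : (fun _ => _) = (fun x : borel_rV R d2 => x 0 j) \o snd).
  by apply: measurableT_comp; [exact: measurable_coord|exact: measurable_snd].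
apply/funext => z /=; rewrite /r (_ : i = rshift d1 j) ?row_mxEr//.
exact: val_inj.
Qed.

Lemma measurable_row_step {dT} {T : measurableType dT} d (t : R)
    (g h : T -> borel_rV R d) :
  measurable_fun [set: T] g -> measurable_fun [set: T] h ->
  measurable_fun [set: T]
    (fun w => ((g w : 'rV[R]_d) + t *: (h w : 'rV[R]_d))%R : borel_rV R d).
Proof.
move=> mg mh; apply: measurable_fun_rV => i.
rewrite (_ : (fun _ => _) = (fun w => (g w : 'rV[R]_d) 0 i + t * (h w : 'rV[R]_d) 0 i)).
  apply: measurable_funD.
    exact: (measurableT_comp (@measurable_coord d i) mg).
  apply: measurable_funM => //.
  exact: (measurableT_comp (@measurable_coord d i) mh).
by apply/funext => w; rewrite !mxE.
Qed.

End BorelVectors.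

(** * Independence of the state and the remaining draws *)

Section Freshness.
Context {R : realType} {dO dXi : measure_display}.
Context {Omega : measurableType dO} {Xi : measurableType dXi}.
Variables (Q : probability Omega R) (I : choiceType) (X : I -> {RV Q >-> Xi}).
Local Open Scope ereal_scope.

Definition draws_event (J : seq I) (B : I -> set Xi) : set Omega :=
  \bigcap_(i in [set` J]) X i @^-1` B i.

(** Joint independence of [Z] and all draws with index in [K]. Quantifying over finite families of
    draws, not single ones, is what lets the property survive when a draw is appended to the
    state. *)
Definition fresh (K : set I) dS (S : measurableType dS) (Z : Omega -> S) :=
  forall (J : seq I) (A : set S) (B : I -> set Xi), uniq J ->
    (forall i, i \in J -> K i /\ measurable (B i)) -> measurable A ->
    Q (Z @^-1` A `&` draws_event J B) =
      Q (Z @^-1` A) * \prod_(i <- J) Q (X i @^-1` B i).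

Lemma measurable_preimage dS (S : measurableType dS) (Z : Omega -> S) A :
  measurable_fun setT Z -> measurable A -> measurable (Z @^-1` A).
Proof. by move=> mZ mA; rewrite -[X in measurable X]setTI; exact: mZ. Qed.

Lemma measurable_draws_event J B : (forall i, i \in J -> measurable (B i)) ->
  measurable (draws_event J B).
Proof.
move=> mB; apply: fin_bigcap_measurable; first exact: finite_seq.
by move=> i /= iJ; apply: measurable_preimage => //; exact: mB.
Qed.

Lemma fresh_cst K dS (S : measurableType dS) (s : S) :
  mutually_independent X -> fresh K (fun=> s).
Proof.
move=> indX J A B uJ KB mA; rewrite (_ : _ @^-1` _ = if s \in A then setT else set0).
  case: ifPn => _; last by rewrite set0I measure0 mul0e.
  rewrite setTI probability_setT mul1e; apply: indX => // i iJ.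
  by have [] := KB i iJ.
apply/seteqP; split => w /=; case: ifPn => //.
  by rewrite notin_setE.
by rewrite inE.
Qed.

Lemma fresh_sub K K' dS (S : measurableType dS) (Z : Omega -> S) :
  K' `<=` K -> fresh K Z -> fresh K' Z.
Proof.
by move=> KK' fZ J A B uJ KB; apply: fZ => // i /KB[/KK'].
Qed.

Lemma fresh_comp K dS (S : measurableType dS) dS' (S' : measurableType dS')
    (Z : Omega -> S) (h : S -> S') :
  measurable_fun setT h -> fresh K Z -> fresh K (h \o Z).
Proof.
move=> mh fZ J A B uJ KB mA; rewrite comp_preimage; apply: fZ => //.
by rewrite -[X in measurable X]setTI; exact: mh.
Qed.

Section Pair.
Context {dS} {S : measurableType dS} (Z : Omega -> S) (K : set I) (j : I).
Hypotheses (mZ : measurable_fun setT Z) (fZ : fresh K Z) (Kj : K j).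

Let joint w := (Z w, X j w).

Let mjoint : measurable_fun setT joint.
Proof. by apply: measurable_fun_pair. Qed.

Lemma fresh_rect A B : measurable A -> measurable B ->
  Q (joint @^-1` (A `*` B)) = Q (Z @^-1` A) * Q (X j @^-1` B).
Proof.
move=> mA mB.
have := @fZ [:: j] A (fun=> B) isT _ mA; rewrite big_seq1 => <-.
  rewrite /draws_event (_ : [set` [:: j]] = [set j]) ?bigcap_set1//.
  by apply/seteqP; split => i /=; rewrite inE => /eqP.
by move=> i; rewrite inE => /eqP ->.
Qed.

(** For a fixed event of the other draws, both sides are finite measures in [E], so it suffices to
    compare them on rectangles, a pi-system. On a rectangle, the side [D] becomes one more draw
    event at [j] (the family [B']), and freshness of [Z] applies to [j :: J]. *)
Lemma fresh_pair : fresh (K `\ j) joint.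
Proof.
move=> J E B uJ KB mE.
have mC : measurable (draws_event J B).
  by apply: measurable_draws_event => i /KB[].
have QC : Q (draws_event J B) = \prod_(i <- J) Q (X i @^-1` B i).
  have := @fZ J setT B uJ _ measurableT.
  rewrite preimage_setT setTI probability_setT mul1e; apply.
  by move=> i /KB[[]].
have fQC : fine (Q (draws_event J B)) \is Num.nneg.
  by rewrite nnegrE fine_ge0.
pose c := NngNum fQC.
have cE : (c%:num)%:E = Q (draws_event J B).
  by rewrite /= fineK// fin_num_measure.
(* The measurability of [joint], needed by the measure structure on
   [pushforward m joint], becomes the first argument of [push]. *)
pose push (m : {measure set Omega -> \bar R})
  : {measure set (S * Xi) -> \bar R} := pushforward m joint.
pose m1 := push mjoint (mrestr Q mC).
pose m2 : {measure set (S * Xi) -> \bar R} := mscale c (push mjoint Q).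
suff -> : Q (joint @^-1` E `&` draws_event J B) = m2 E.
  by rewrite /m2 /= /mscale /= -/(c%:num) cE QC muleC.
have rectG : @measurable _ (S * Xi)%type =
  <<s [set A `*` B | A in @measurable _ S & B in @measurable _ Xi] >>.
  exact: measurable_prod_measurableType.
apply: (measure_unique _ (fun=> setT) rectG _ _ _ m1 m2) => //.
- move=> _ _ [A1 mA1 [B1 mB1 <-]] [A2 mA2 [B2 mB2 <-]].
  rewrite -setXI; exists (A1 `&` A2); first exact: measurableI.
  by exists (B1 `&` B2); first exact: measurableI.
- by move=> _; exists setT => //; exists setT => //; rewrite setXTT.
- by rewrite bigcup_const.
- move=> _ [A mA [D mD <-]].
  have jJ : j \notin J by apply/negP => /KB[[_ /(_ erefl)]].
  pose B' i := if i == j then D else B i.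
  have B'J i : i \in J -> B' i = B i.
    by rewrite /B'; case: eqP => // ->; rewrite (negbTE jJ).
  have -> : m1 (A `*` D) = Q (Z @^-1` A `&` draws_event (j :: J) B').
    rewrite /m1 /= /pushforward /mrestr /draws_event; congr (Q _).
    apply/seteqP; split => w /=.
      move=> [[Aw Dw] Bw]; split => // i /=; rewrite inE => /predU1P[->|iJ].
        by rewrite /B' eqxx.
      by rewrite /preimage/= B'J//; exact: Bw.
    move=> [Aw Bw]; split; first split => //.
      by have /= := Bw j; rewrite /B' eqxx; apply; exact: mem_head.
    by move=> i /= iJ; rewrite -B'J//; apply: Bw; rewrite /= inE iJ orbT.
  rewrite fZ//=.
  + rewrite big_cons {1}/B' eqxx muleA -fresh_rect// muleC /m2 /mscale /= cE QC.
    by congr (_ * _); apply: eq_big_seq => i iJ; rewrite B'J.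
  + by rewrite jJ.
  + move=> i; rewrite inE => /predU1P[->|iJ]; first by rewrite /B' eqxx.
    by rewrite B'J//; have [[]] := KB i iJ.
- move=> _; rewrite /m1 /= /pushforward /mrestr ltey_eq fin_num_measure//.
  by apply: measurableI => //; exact: measurable_preimage.
Qed.

(** The joint law of [Z] and [X j] is the product of the law of [Z] with [P], and Tonelli applies as
    [phi] is nonnegative. This plays the part of conditioning on the state. *)
Lemma fresh_integral (P : probability Xi R) (phi : S * Xi -> \bar R) :
  (forall A, measurable A -> Q (X j @^-1` A) = P A) ->
  measurable_fun setT phi -> (forall u, 0 <= phi u) ->
  \int[Q]_w phi (Z w, X j w) = \int[Q]_w \int[P]_xi phi (Z w, xi).
Proof.
move=> XP mphi phi0.
pose zf := mfun_Sub (mem_set mZ : Z \in mfun).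
transitivity (\int[distribution Q zf \x P]_u phi u).
  transitivity (\int[pushforward Q joint]_u phi u).
    by rewrite (ge0_integral_pushforward mjoint).
  apply: eq_measure_integral => E mE _.
  pose push (m : {measure set Omega -> \bar R})
    : {measure set (S * Xi) -> \bar R} := pushforward m joint.
  rewrite -[LHS]/(push mjoint Q E); apply/esym/product_measure_unique => //.
  move=> A B mA mB.
  by transitivity (Q (Z @^-1` A) * Q (X j @^-1` B));
    [exact: fresh_rect|congr (_ * _); exact: XP].
rewrite fubini_tonelli1//= ge0_integral_pushforward//.
- exact: measurable_fun_fubini_tonelli_F.
- by move=> z _; exact: integral_ge0.
Qed.

End Pair.

End Freshness.

(** * Convergence *)

Section Convergence.
Context {R : realType} {d1 d2 : nat}.
Variables (f : 'rV[R]_d1 -> 'rV[R]_d2 -> R) (l mu1 mu2 : R).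
Hypotheses (hC1 : continuously_differentiable f) (hl : 0 < l).
Hypotheses (hlip : lipschitz_gradient f l) (hsaddle : saddle_point_existence f).
Hypotheses (hmu1 : 0 < mu1) (hmu2 : 0 < mu2) (hPL : two_sided_PL f mu1 mu2).
Hypotheses (hmu1l : mu1 <= l) (hmu2l : mu2 <= l).
Context {dXi : measure_display} {Xi : measurableType dXi}.
Variables (P : probability Xi R).
Variables (Gx : 'rV[R]_d1 -> 'rV[R]_d2 -> Xi -> 'rV[R]_d1).
Variables (Gy : 'rV[R]_d1 -> 'rV[R]_d2 -> Xi -> 'rV[R]_d2) (sigma : R).
Hypothesis hGx : unbiased_bounded_variance P Gx (gradx f) sigma.
Hypothesis hGy : unbiased_bounded_variance P Gy (grady f) sigma.
Variables (tau1 tau2 : R).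
Hypothesis htau2 : 0 < tau2 <= 1 / l.
Hypothesis htau1 : 0 < tau1 <= mu2 ^+ 2 * tau2 / (18 * l ^+ 2).

Notation state := (borel_rV R d1 * borel_rV R d2)%type.

Definition step_x (u : state * Xi) : state :=
  ((u.1.1 : 'rV[R]_d1) - tau1 *: Gx u.1.1 u.1.2 u.2, u.1.2).

Definition step_y (u : state * Xi) : state :=
  (u.1.1, (u.1.2 : 'rV[R]_d2) + tau2 *: Gy u.1.1 u.1.2 u.2).

Lemma measurable_step_x : measurable_fun setT step_x.
Proof.
apply: measurable_fun_pair; last first.
  exact: (measurableT_comp measurable_snd measurable_fst).
under eq_fun do rewrite -scaleNr.
apply: measurable_row_step; last by case: hGx.
exact: (measurableT_comp measurable_fst measurable_fst).
Qed.

Lemma measurable_step_y : measurable_fun setT step_y.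
Proof.
apply: measurable_fun_pair.
  exact: (measurableT_comp measurable_fst measurable_fst).
apply: measurable_row_step; last by case: hGy.
exact: (measurableT_comp measurable_snd measurable_fst).
Qed.

Lemma measurable_f :
  measurable_fun [set: state] (fun u : state => f u.1 u.2).
Proof.
apply: continuous_measurable_rV2 => u; have [df _ _] := hC1.
exact: (differentiable_continuous (df u)).
Qed.

Lemma measurable_max_y :
  measurable_fun [set: state] (fun u : state => max_y f u.1).
Proof.
apply: (measurableT_comp (f := max_y f : borel_rV R d1 -> R)).
  apply: continuous_measurable_rV.
  exact: (continuous_max_y hsaddle hC1 hl hlip hmu2 hPL).
exact: measurable_fst.
Qed.

Let V (u : state) := lyapunov f u.1 u.2.
Let U (u : state) := lyapunov_mid f l mu2 sigma tau2 u.1 u.2.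

Lemma measurable_lyapunov : measurable_fun setT V.
Proof.
apply: measurable_funD.
  by apply: measurable_funB; [exact: measurable_max_y|exact: measurable_cst].
apply: measurable_funM; first exact: measurable_cst.
by apply: measurable_funB; [exact: measurable_max_y|exact: measurable_f].
Qed.

Lemma measurable_lyapunov_mid : measurable_fun setT U.
Proof.
apply: measurable_funD.
  by apply: measurable_funB; [exact: measurable_max_y|exact: measurable_cst].
apply: measurable_funM; first exact: measurable_cst.
apply: measurable_funD; last exact: measurable_cst.
apply: measurable_funM; first exact: measurable_cst.
by apply: measurable_funB; [exact: measurable_max_y|exact: measurable_f].
Qed.

Lemma measurable_estimator_coord d (G : 'rV[R]_d1 -> 'rV[R]_d2 -> Xi -> 'rV[R]_d)
    v x y i :
  unbiased_bounded_variance P G v sigma ->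
  measurable_fun setT (fun xi => G x y xi 0 i).
Proof.
case=> mG _ _.
exact: (measurableT_comp (@measurable_coord R d i)
  (measurable_fun_pair2 ((x, y) : state) mG)).
Qed.

Lemma integral_step_y u :
  (\int[P]_xi (V (step_y (u, xi)))%:E <= (U u)%:E)%E.
Proof.
case: u => x y; have [_ EG VG] := hGy.
apply: (expected_dual_step hC1 hl hlip hsaddle hPL htau2 (G := Gy x y)) => //.
  by move=> i; exact: measurable_estimator_coord hGy.
exact: (measurableT_comp measurable_lyapunov
  (measurable_fun_pair2 ((x, y) : state) measurable_step_y)).
Qed.

Let rho := 1 - 1 / 2 * mu1 * tau1.
Let L := l + l ^+ 2 / mu2.
Let noise := ((1 - mu2 * tau2) * (L + l) * tau1 ^+ 2 + l * tau2 ^+ 2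
              + 10 * L * tau1 ^+ 2) / 20 * sigma ^+ 2.

Lemma integral_step_x u :
  (\int[P]_xi (U (step_x (u, xi)))%:E <= (rho * V u + noise)%:E)%E.
Proof.
case: u => x y; have [_ EG VG] := hGx.
apply: (expected_primal_step hC1 hl hlip hsaddle hmu1 hmu2 hPL hmu1l hmu2l
  htau2 htau1 (G := Gx x y)) => //.
  by move=> i; exact: measurable_estimator_coord hGx.
exact: (measurableT_comp measurable_lyapunov_mid
  (measurable_fun_pair2 ((x, y) : state) measurable_step_x)).
Qed.

Context {dO : measure_display} {Omega : measurableType dO}.
Variables (Q : probability Omega R) (xi1 xi2 : nat -> {RV Q >-> Xi}).
Hypothesis hxi : iid_samples P xi1 xi2.
Variables (x0 : 'rV[R]_d1) (y0 : 'rV[R]_d2).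

Let z t w : state := stoc_agda Gx Gy (fun=> tau1) (fun=> tau2) x0 y0
  (fun s => xi1 s w) (fun s => xi2 s w) t.

Let draw (k : nat + nat) : {RV Q >-> Xi} :=
  match k with inl t => xi1 t | inr t => xi2 t end.

(** The comparison is not strict because the iterate at time [t] has consumed only draws of earlier
    times. *)
Let future t : set (nat + nat) :=
  [set k | match k with inl s => (t <= s)%N | inr s => (t <= s)%N end].

(** The half-step has its own name because [Gy] is evaluated at the new [x] and the old [y], and
    [xi2 t] must be fresh for exactly this state. *)
Let zmid t w : state := step_x (z t w, xi1 t w).

Lemma iterateS t : z t.+1 = step_y \o (fun w => (zmid t w, xi2 t w)).
Proof. by []. Qed.

Lemma measurable_zmid t : measurable_fun setT (z t) -> measurable_fun setT (zmid t).
Proof.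
move=> mz; apply: (measurableT_comp measurable_step_x).
by apply: measurable_fun_pair => //; exact: measurable_funP.
Qed.

Lemma measurable_iterate t : measurable_fun setT (z t).
Proof.
elim: t => [|t IH]; first exact: measurable_cst.
rewrite iterateS; apply: (measurableT_comp measurable_step_y).
by apply: measurable_fun_pair; [exact: measurable_zmid|exact: measurable_funP].
Qed.

Lemma fresh_zmid t : fresh draw (future t) (z t) ->
  fresh draw (future t `\ inl t) (zmid t).
Proof.
move=> fz; apply: (fresh_comp measurable_step_x).
exact: (fresh_pair (j := inl t) (measurable_iterate t) fz (leqnn t)).
Qed.

(** One iteration consumes [inl t] and then [inr t]; every index in the future of [t.+1] differs
    from both. *)
Lemma fresh_iterate t : fresh draw (future t) (z t).
Proof.
elim: t => [|t IH]; first by apply: fresh_cst; case: hxi.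
rewrite iterateS; apply: (fresh_comp measurable_step_y).
have mzm := measurable_zmid (measurable_iterate t).
have Kt : (future t `\ inl t) (inr t) by split => //=; exact: leqnn.
have := fresh_pair (j := inr t) mzm (fresh_zmid IH) Kt.
apply: fresh_sub => -[s|s] /= ts; (split; first split) => //=.
- exact: ltnW.
- by move=> [st]; rewrite st ltnn in ts.
- exact: ltnW.
- by move=> [st]; rewrite st ltnn in ts.
Qed.

Lemma rho_ge0 : 0 <= rho.
Proof.
move: htau1 htau2 => /andP[t10 t1] /andP[t20].
rewrite ler_pdivlMr// => t2; move: t1.
have l2 : 0 < l ^+ 2 by rewrite exprn_gt0.
rewrite ler_pdivlMr ?mulr_gt0// => t1.
have m2l : mu2 ^+ 2 * tau2 <= l ^+ 2 * tau2.
  by rewrite ler_pM2r// ler_pXn2r ?nnegrE// ltW.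
have ml : l * (mu1 * tau1) <= l * (l * tau1) by rewrite ler_pM2l// ler_pM2r.
have : l * (18 * (mu1 * tau1)) <= l * 1.
  by have := ler_wpM2l (ltW hl) t2; move: ml; rewrite !expr2 in t1 m2l *; lra.
rewrite ler_pM2l// /rho; lra.
Qed.

Lemma noise_ge0 : 0 <= noise.
Proof.
have q0 : 0 <= 1 - mu2 * tau2 by rewrite subr_ge0; exact: (mu2_tau2_le1 hl hmu2l htau2).
have L0 : 0 <= L by rewrite /L addr_ge0 ?(ltW hl)// divr_ge0 ?sqr_ge0// ltW.
have t20 : 0 < tau2 by case/andP: htau2.
have [l0 t0] := (ltW hl, ltW t20).
rewrite /noise mulr_ge0 ?sqr_ge0// divr_ge0// !addr_ge0//.
- by rewrite mulr_ge0 ?sqr_ge0// mulr_ge0// addr_ge0.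
- by rewrite mulr_ge0 ?sqr_ge0.
- by rewrite mulr_ge0 ?sqr_ge0// mulr_ge0.
Qed.

(** The draws are integrated out in reverse order: [xi2 t] given the half-step, which leaves the
    expectation of [U], then [xi1 t] given the iterate. *)
Lemma lyapunov_step t :
  (\int[Q]_w (V (z t.+1 w))%:E <=
     rho%:E * \int[Q]_w (V (z t w))%:E + noise%:E)%E.
Proof.
have [law _] := hxi.
have mz := measurable_iterate t; have mzm := measurable_zmid mz.
have V0 u : 0 <= V u by exact: lyapunov_ge0.
have U0 u : 0 <= U u by exact: lyapunov_mid_ge0.
have mVy : measurable_fun setT (fun u => (V (step_y u))%:E).
  apply/measurable_EFinP.
  exact: (measurableT_comp measurable_lyapunov measurable_step_y).
have mUx : measurable_fun setT (fun u => (U (step_x u))%:E).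
  apply/measurable_EFinP.
  exact: (measurableT_comp measurable_lyapunov_mid measurable_step_x).
have Kt : (future t `\ inl t) (inr t) by split => //=; exact: leqnn.
have inner (g : state * Xi -> \bar R) : measurable_fun setT g ->
    (forall u, 0 <= g u)%E ->
    measurable_fun setT (fun u => \int[P]_xi g (u, xi))%E.
  by move=> mg g0; exact: measurable_fun_fubini_tonelli_F.
have -> : (\int[Q]_w (V (z t.+1 w))%:E =
    \int[Q]_w \int[P]_xi (V (step_y (zmid t w, xi)))%:E)%E.
  apply: (fresh_integral (j := inr t) mzm (fresh_zmid (@fresh_iterate t)) Kt
    (phi := fun u => (V (step_y u))%:E) _ mVy) => [A mA|u].
    by have [_ <-] := law t A mA.
  by rewrite lee_fin.
apply: (@le_trans _ _ (\int[Q]_w (U (zmid t w))%:E)%E).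
  apply: ge0_le_integral => //.
  - by move=> w _; apply: integral_ge0 => xi _; rewrite lee_fin.
  - apply: (measurableT_comp (inner _ mVy _) mzm) => u.
    by rewrite lee_fin.
  - apply/measurable_EFinP.
    exact: (measurableT_comp measurable_lyapunov_mid mzm).
  - by move=> w _; exact: integral_step_y.
have -> : (\int[Q]_w (U (zmid t w))%:E =
    \int[Q]_w \int[P]_xi (U (step_x (z t w, xi)))%:E)%E.
  apply: (fresh_integral (j := inl t) mz (@fresh_iterate t) (leqnn t)
    (phi := fun u => (U (step_x u))%:E) _ mUx) => [A mA|u].
    by have [<- _] := law t A mA.
  by rewrite lee_fin.
apply: (@le_trans _ _ (\int[Q]_w (rho%:E * (V (z t w))%:E + noise%:E))%E).
  apply: ge0_le_integral => //.
  - by move=> w _; apply: integral_ge0 => xi _; rewrite lee_fin.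
  - apply: (measurableT_comp (inner _ mUx _) mz) => u.
    by rewrite lee_fin.
  - apply/measurable_EFinP; apply: measurable_funD; last exact: measurable_cst.
    apply: measurable_funM; first exact: measurable_cst.
    exact: (measurableT_comp measurable_lyapunov mz).
  - by move=> w _; rewrite -EFinM -EFinD; exact: integral_step_x.
have mVz : measurable_fun setT (fun w => (V (z t w))%:E).
  by apply/measurable_EFinP; exact: (measurableT_comp measurable_lyapunov mz).
rewrite ge0_integralD//=.
- rewrite integral_cst//= probability_setT mule1 ge0_integralZl//.
  + by move=> w _; rewrite lee_fin.
  + by rewrite lee_fin rho_ge0.
- by move=> w _; rewrite -EFinM lee_fin mulr_ge0// rho_ge0.
- by apply: emeasurable_funM => //; exact: measurable_cst.
- by move=> w _; rewrite lee_fin noise_ge0.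
Qed.

(** Both gaps are nonnegative, so additivity of the integral holds even if an expectation were
    infinite. *)
Lemma potentialE t : potential Q f z t = (\int[Q]_w (V (z t w))%:E)%E.
Proof.
have mg : measurable_fun setT (fun w => max_y f (z t w).1).
  exact: (measurableT_comp measurable_max_y (measurable_iterate t)).
have mfz : measurable_fun setT (fun w => f (z t w).1 (z t w).2).
  exact: (measurableT_comp measurable_f (measurable_iterate t)).
have g0 w : 0 <= max_y f (z t w).1 - min_max f.
  by rewrite subr_ge0 min_max_le.
have d0 w : 0 <= max_y f (z t w).1 - f (z t w).1 (z t w).2.
  by rewrite subr_ge0 le_max_y.
have md : measurable_fun setT
    (fun w => (max_y f (z t w).1 - f (z t w).1 (z t w).2)%:E).
  by apply/measurable_EFinP; exact: measurable_funB.
rewrite /potential /primal_gap /dual_gap unlock -ge0_integralZl//.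
rewrite -ge0_integralD//.
- by move=> w _; rewrite lee_fin.
- by apply/measurable_EFinP; apply: measurable_funB => //; exact: measurable_cst.
- by move=> w _; rewrite -EFinM lee_fin mulr_ge0// divr_ge0.
- by apply: emeasurable_funM => //; exact: measurable_cst.
- by move=> w _; rewrite lee_fin.
Qed.

Lemma potential_bound t :
  (potential Q f z t <= (rho ^+ t)%:E * potential Q f z 0
    + (noise / (1 / 2 * mu1 * tau1))%:E)%E.
Proof.
have k0 : 0 < 1 / 2 * mu1 * tau1.
  by rewrite !mulr_gt0//; case/andP: htau1.
(* The initial state is deterministic, so the initial potential is a real number and the induction
   can be run on real bounds. *)
have E0 : potential Q f z 0 = (lyapunov f x0 y0)%:E.
  rewrite potentialE [LHS](integral_cst Q measurableT (lyapunov f x0 y0)%:E).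
  by rewrite /= probability_setT mule1.
rewrite E0 -EFinM -EFinD.
elim: t => [|t IH].
  rewrite E0 lee_fin.
  by rewrite expr0 (mul1r (lyapunov _ _ _)) lerDl divr_ge0// ?noise_ge0// ltW.
rewrite potentialE (le_trans (lyapunov_step t))// -potentialE.
apply: (@le_trans _ _ (rho%:E * (rho ^+ t * lyapunov f x0 y0
    + noise / (1 / 2 * mu1 * tau1))%:E + noise%:E)%E).
  by rewrite leeD2r// lee_wpmul2l// lee_fin rho_ge0.
rewrite -EFinM -EFinD lee_fin exprS.
set K := noise / _.
(* With [1 - rho = 1 / 2 * mu1 * tau1], the offset [K] is the fixed point of the recursion:
   [rho * K + noise = K]. *)
have -> : noise = (1 / 2 * mu1 * tau1) * K by rewrite /K mulrC divfK// gt_eqF.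
rewrite /rho; lra.
Qed.

End Convergence.

Unset Implicit Arguments.

Theorem theorem3p1 (R : realType) (d1 d2 : nat)
  (f : 'rV[R]_d1 -> 'rV[R]_d2 -> R) (l mu1 mu2 : R)
  (hC1 : continuously_differentiable f)
  (hl : 0 < l) (hlip : lipschitz_gradient f l)
  (hsaddle : saddle_point_existence f)
  (hmu1 : 0 < mu1) (hmu2 : 0 < mu2) (hPL : two_sided_PL f mu1 mu2)
  (hmu1l : mu1 <= l) (hmu2l : mu2 <= l)
  (dXi : measure_display) (Xi : measurableType dXi) (P : probability Xi R)
  (Gx : 'rV[R]_d1 -> 'rV[R]_d2 -> Xi -> 'rV[R]_d1)
  (Gy : 'rV[R]_d1 -> 'rV[R]_d2 -> Xi -> 'rV[R]_d2) (sigma : R)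
  (hGx : unbiased_bounded_variance P Gx (gradx f) sigma)
  (hGy : unbiased_bounded_variance P Gy (grady f) sigma)
  (dO : measure_display) (Omega : measurableType dO) (Q : probability Omega R)
  (xi1 xi2 : nat -> {RV Q >-> Xi}) (hxi : iid_samples P xi1 xi2)
  (x0 : 'rV[R]_d1) (y0 : 'rV[R]_d2) (tau1 tau2 : R)
  (htau2 : 0 < tau2 <= 1 / l)
  (htau1 : 0 < tau1 <= mu2 ^+ 2 * tau2 / (18 * l ^+ 2)) :
  let z := fun (t : nat) (w : Omega) =>
    stoc_agda Gx Gy (fun=> tau1) (fun=> tau2) x0 y0
      (fun s => xi1 s w) (fun s => xi2 s w) t in
  let L := l + l ^+ 2 / mu2 in
  let delta :=
    ((1 - mu2 * tau2) * (L + l) * tau1 ^+ 2 + l * tau2 ^+ 2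
       + 10 * L * tau1 ^+ 2) / (10 * mu1 * tau1) * sigma ^+ 2 in
  forall t : nat,
    (potential Q f z t
       <= ((1 - 1 / 2 * mu1 * tau1) ^+ t)%:E * potential Q f z 0 + delta%:E)%E.
Proof.
move=> z L delta t.
have t10 : 0 < tau1 by case/andP: htau1.
(* The denominator [10 * mu1 * tau1] is the 20 of the per-step noise times the contraction rate
   [1 / 2 * mu1 * tau1]. *)
suff -> : delta = ((1 - mu2 * tau2) * (L + l) * tau1 ^+ 2 + l * tau2 ^+ 2
       + 10 * L * tau1 ^+ 2) / 20 * sigma ^+ 2 / (1 / 2 * mu1 * tau1).
  exact: (potential_bound hC1 hl hlip hsaddle hmu1 hmu2 hPL hmu1l hmu2l hGx hGy
    htau2 htau1 hxi x0 y0 t).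
by rewrite /delta; field; rewrite !gt_eqF.
Qed.
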